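(* For each $c\in(0,\infty)$, define the function $g$ on $(0,1)$ by $$g(r)=\left(\frac34+cr^2\right)\log\frac{\operatorname{arth} r}{r}-\log\frac{2\mathcal{K}(r)}{\pi}.$$ Then $g$ is strictly increasing on $(0,1)$ if and only if $c\geq 1/4$, and $g$ is strictly decreasing on $(0,1)$ if and only if $c\leq 1/320$. Moreover $g(0^+)=0$, and $g(1^-)=\log(\pi/2)$ if $c=1/4$, $g(1^-)=\infty$ if $c>1/4$, and $g(1^-)=-\infty$ if $c<1/4$. Moreover, if $c\geq1/4$ then $g$ is convex on $(0,1)$, and if $c\leq1/320$ then $g$ is concave on $(0,1)$.
   Context: $\operatorname{arth}$ denotes the inverse hyperbolic tangent. For $r\in(0,1)$, $\mathcal{K}(r)=\int_0^{\pi/2}(1-r^2\sin^2t)^{-1/2}\,dt$ is the complete elliptic integral of the first kind. $h(0^+)$ and $h(1^-)$ denote the one-sided limits of $h$ at $0$ and $1$. *)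

(* Defs.v *)
From Stdlib Require Import Reals Lra.
From Coquelicot Require Import Coquelicot.
Open Scope R_scope.

(* Meaningful for -1 < r < 1, where it is the inverse of [tanh]:
   see [tanh_arth] and [arth_tanh]. *)
Definition arth (r : R) : R := / 2 * ln ((1 + r) / (1 - r)).

(* Meaningful for 0 < r < 1, where the Riemann integral exists:
   see [ex_RInt_ellipticK]. *)
Definition ellipticK (r : R) : R :=
  RInt (fun t => / sqrt (1 - r ^ 2 * sin t ^ 2)) 0 (PI / 2).

Definition g (c r : R) : R :=
  (3 / 4 + c * r ^ 2) * ln (arth r / r) - ln (2 * ellipticK r / PI).

Definition strictly_increasing_on (a b : R) (f : R -> R) : Prop :=
  forall x y : R, a < x < b -> a < y < b -> x < y -> f x < f y.

Definition strictly_decreasing_on (a b : R) (f : R -> R) : Prop :=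
  forall x y : R, a < x < b -> a < y < b -> x < y -> f y < f x.

Definition convex_on (a b : R) (f : R -> R) : Prop :=
  forall x y t : R, a < x < b -> a < y < b -> 0 <= t <= 1 ->
    f (t * x + (1 - t) * y) <= t * f x + (1 - t) * f y.

Definition concave_on (a b : R) (f : R -> R) : Prop :=
  forall x y t : R, a < x < b -> a < y < b -> 0 <= t <= 1 ->
    t * f x + (1 - t) * f y <= f (t * x + (1 - t) * y).

(* One-sided limits f(x^+) = l and f(x^-) = l, possibly infinite. *)
Definition is_lim_right (f : R -> R) (x : R) (l : Rbar) : Prop :=
  filterlim f (at_right x) (Rbar_locally l).

Definition is_lim_left (f : R -> R) (x : R) (l : Rbar) : Prop :=
  filterlim f (at_left x) (Rbar_locally l).

Lemma tanh_arth (r : R) : -1 < r < 1 -> tanh (arth r) = r.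
Proof.
intros Hr; unfold tanh, sinh, cosh.
assert (Hq : 0 < (1 + r) / (1 - r)) by (apply Rdiv_lt_0_compat; lra).
assert (H2 : exp (arth r) * exp (arth r) = (1 + r) / (1 - r)).
{ rewrite <- exp_plus; unfold arth.
  set (l := ln ((1 + r) / (1 - r))).
  replace (/ 2 * l + / 2 * l) with l by field.
  now apply exp_ln. }
rewrite exp_Ropp.
assert (He := exp_pos (arth r)); set (e := exp (arth r)) in *.
replace ((e - / e) / 2 / ((e + / e) / 2)) with ((e * e - 1) / (e * e + 1))
  by (field; split; nra).
rewrite H2; field; lra.
Qed.

Lemma arth_tanh (x : R) : arth (tanh x) = x.
Proof.
unfold arth, tanh, sinh, cosh; rewrite exp_Ropp.
assert (He := exp_pos x).
replace (_ / _) with (exp x * exp x).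
- rewrite ln_mult, ln_exp by easy; field.
- set (e := exp x) in *; field; repeat split; nra.
Qed.

Lemma ex_RInt_ellipticK (r : R) : 0 < r < 1 ->
  ex_RInt (fun t => / sqrt (1 - r ^ 2 * sin t ^ 2)) 0 (PI / 2).
Proof.
intros Hr; apply (ex_RInt_continuous (V := R_CompleteNormedModule)); intros t _.
assert (Hs : sin t ^ 2 <= 1)
  by (generalize (sin2_cos2 t) (Rle_0_sqr (cos t)); unfold Rsqr; nra).
assert (0 < 1 - r ^ 2 * sin t ^ 2) by nra.
apply (ex_derive_continuous (V := R_NormedModule)); auto_derive.
repeat split; [lra | apply Rgt_not_eq, sqrt_lt_R0; lra].
Qed.

(* Main.v *)
Require Import Defs.
From Stdlib Require Import Reals Lra Psatz.
From Coquelicot Require Import Coquelicot.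
Open Scope R_scope.

(* Put x = r^2, A = arth r / r and G(x) = g(r).  Differentiating G twice in x removes the logarithms, and
   b = 1 / A - (1 - x) = 2 x (1 - x) A' / A and th = E / K - (1 - x) = 2 x (1 - x) K' / K
   satisfy the Riccati equations
     b' = 1 - (b + 1 - x) b / (2 x (1 - x)),  th' = 1 / 2 - th^2 / (2 x (1 - x)).
   Hence 4 x^2 (1 - x)^2 G'' is a polynomial in x, b, th.  Comparing th with explicit sub- and
   supersolutions of its equation gives
     (3 / 4 + x / 200) b <= th <= 1 / (1 / b + 1 / (2 x) + 1 / 20),
   which is tight enough at both ends of (0,1) to make G'' > 0 for c = 1/4 and G'' < 0 for c = 1/320,
   b being controlled by Padé approximants of arth and, near x = 1, by
   1 / (1 - x) = cosh (arth r)^2.  G'' increases with c.  The sign of G' and the convexity of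
   g(r) = G(r^2) follow.  The limits at 1 rest on A <= K <= A + PI / 2. *)

(** * The complete elliptic integrals as functions of the squared modulus *)

(** Both thresholds are points of degeneracy. At 0, G(x) = (c / 3 - 1 / 960) x^2 + O(x^3), the
    constant 3 / 4 cancelling the linear term; for c = 1 / 320 the sign of G'' is left to the next
    order, so the upper bound of th has to be exact to second order in x. At 1, ln K - ln A stays
    bounded and G(x) = (c - 1 / 4) ln A + O(1), so c = 1 / 4 is again a cancellation. There b and th
    decay like 1 / A, the inverse of a logarithm, which no rational function of x follows; bounding
    th in terms of b instead of x keeps the comparison of K with A meaningful up to 1. The same two
    expansions yield the necessity of the conditions on c: G tends to minus infinity at 1 if c < 1 /
    4, and G' > 0 near 0 if c > 1 / 320. *)

Lemma sin_pow2_bound (t : R) : 0 <= sin t ^ 2 <= 1.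
Proof. generalize (sin2_cos2 t) (pow2_ge_0 (sin t)) (pow2_ge_0 (cos t)); unfold Rsqr; nra. Qed.

Lemma modulus_pos (x t : R) : x < 1 -> 0 < 1 - x * sin t ^ 2.
Proof. intros Hx; generalize (sin_pow2_bound t); intros; destruct (Rle_dec x 0); nra. Qed.

Lemma is_derive_RInt_modulus (f df : R -> R -> R) (x : R) :
  x < 1 ->
  (forall u t, u < 1 -> is_derive (fun v => f v t) u (df u t)) ->
  (forall u t, u < 1 -> continuity_2d_pt df u t) ->
  (forall u, u < 1 -> ex_RInt (f u) 0 (PI / 2)) ->
  is_derive (fun u => RInt (f u) 0 (PI / 2)) x (RInt (df x) 0 (PI / 2)).
Proof.
intros Hx Hd Hc Hi.
assert (Hloc : locally x (fun u => u < 1)) by (apply (open_lt 1); exact Hx).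
rewrite (RInt_ext (df x) (fun t => Derive (fun u => f u t) x)).
2: { intros t _; symmetry; apply is_derive_unique, Hd, Hx. }
apply is_derive_RInt_param.
- apply filter_imp with (2 := Hloc); intros u Hu t _; exists (df u t); now apply Hd.
- intros t _; apply continuity_2d_pt_ext_loc with (2 := Hc x t Hx).
  destruct Hloc as [e He]; exists e; intros u v Hu _.
  symmetry; apply is_derive_unique, Hd, He, Hu.
- apply filter_imp with (2 := Hloc); exact Hi.
Qed.

(** The argument is the squared modulus: [ellipticK r] and [ellK (r ^ 2)] are convertible, which
    [g_gsq] exploits. *)
Definition ellK (x : R) : R := RInt (fun t => / sqrt (1 - x * sin t ^ 2)) 0 (PI / 2).
Definition ellE (x : R) : R := RInt (fun t => sqrt (1 - x * sin t ^ 2)) 0 (PI / 2).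

Ltac modulus_side H Hs :=
  repeat split; first [exact H | apply Rgt_not_eq; exact H | apply Rgt_not_eq; exact Hs | lra].

Ltac continuous_by_derive :=
  apply (ex_derive_continuous (V := R_NormedModule)); auto_derive.

Lemma continuous_modulus_K (x t : R) : x < 1 ->
  continuous (fun t => / sqrt (1 - x * sin t ^ 2)) t.
Proof.
intros Hx; assert (H := modulus_pos x t Hx); continuous_by_derive.
simpl in *; repeat split; [lra | apply Rgt_not_eq, sqrt_lt_R0; lra].
Qed.

Lemma continuous_modulus_E (x t : R) : x < 1 ->
  continuous (fun t => sqrt (1 - x * sin t ^ 2)) t.
Proof.
intros Hx; assert (H := modulus_pos x t Hx); continuous_by_derive.
simpl in *; repeat split; lra.
Qed.

Lemma ex_RInt_modulus_K (x : R) : x < 1 ->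
  ex_RInt (fun t => / sqrt (1 - x * sin t ^ 2)) 0 (PI / 2).
Proof.
intros Hx; apply (ex_RInt_continuous (V := R_CompleteNormedModule)).
intros; now apply continuous_modulus_K.
Qed.

Lemma ex_RInt_modulus_E (x : R) : x < 1 ->
  ex_RInt (fun t => sqrt (1 - x * sin t ^ 2)) 0 (PI / 2).
Proof.
intros Hx; apply (ex_RInt_continuous (V := R_CompleteNormedModule)).
intros; now apply continuous_modulus_E.
Qed.

Lemma continuity_2d_pt_modulus (x t : R) :
  continuity_2d_pt (fun u v => 1 - u * sin v ^ 2) x t.
Proof.
apply continuity_2d_pt_minus; [apply continuity_2d_pt_const |].
apply continuity_2d_pt_mult; [apply continuity_2d_pt_id1 |].
apply (continuity_1d_2d_pt_comp (fun v => sin v ^ 2) (fun _ v => v)).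
- apply derivable_continuous_pt, ex_derive_Reals_0; auto_derive; auto.
- apply continuity_2d_pt_id2.
Qed.

Lemma continuity_2d_pt_modulus_comp (h : R -> R) (x t : R) :
  x < 1 -> (forall z, 0 < z -> ex_derive h z) ->
  continuity_2d_pt (fun u v => sin v ^ 2 * h (1 - u * sin v ^ 2)) x t.
Proof.
intros Hx Hh; apply continuity_2d_pt_mult.
- apply (continuity_1d_2d_pt_comp (fun v => sin v ^ 2) (fun _ v => v)).
  + apply derivable_continuous_pt, ex_derive_Reals_0; auto_derive; auto.
  + apply continuity_2d_pt_id2.
- apply (continuity_1d_2d_pt_comp h (fun u v => 1 - u * sin v ^ 2)).
  + apply derivable_continuous_pt, ex_derive_Reals_0, Hh, modulus_pos, Hx.
  + apply continuity_2d_pt_modulus.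
Qed.

(** With q = 1 - x sin^2 t, the derivative of the integrand is - sin^2 t / (2 sqrt q) = (sqrt q - 1
    / sqrt q) / (2 x), a combination of the integrands of E and K. *)
Lemma is_derive_ellE (x : R) : 0 < x < 1 -> is_derive ellE x ((ellE x - ellK x) / (2 * x)).
Proof.
intros Hx.
assert (Hd : is_derive ellE x
  (RInt (fun t => sin t ^ 2 * (- / (2 * sqrt (1 - x * sin t ^ 2)))) 0 (PI / 2))).
{ apply (is_derive_RInt_modulus (fun u t => sqrt (1 - u * sin t ^ 2))
    (fun u t => sin t ^ 2 * (- / (2 * sqrt (1 - u * sin t ^ 2))))); [lra | | |].
  - intros u t Hu; assert (H := modulus_pos u t Hu).
    assert (Hs := sqrt_lt_R0 _ H).
    auto_derive; [simpl in *; lra | simpl in *].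
    replace (1 + - (u * (sin t * (sin t * 1)))) with (1 - u * (sin t * (sin t * 1))) by ring. field; lra.
  - intros u t Hu.
    apply (continuity_2d_pt_modulus_comp (fun z => - / (2 * sqrt z)) u t Hu).
    intros z Hz; assert (Hs := sqrt_lt_R0 _ Hz); auto_derive; repeat split; lra.
  - intros; now apply ex_RInt_modulus_E. }
replace ((ellE x - ellK x) / (2 * x)) with
  (RInt (fun t => sin t ^ 2 * (- / (2 * sqrt (1 - x * sin t ^ 2)))) 0 (PI / 2)); [exact Hd |].
apply is_RInt_unique.
apply is_RInt_ext with
  (fun t => scal (/ (2 * x)) (minus (sqrt (1 - x * sin t ^ 2)) (/ sqrt (1 - x * sin t ^ 2)))).
- intros t _; assert (H := modulus_pos x t (proj2 Hx)).
  assert (Hs := sqrt_lt_R0 _ H); assert (Hq := sqrt_sqrt _ (Rlt_le _ _ H)).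
  unfold scal, minus, plus, opp; simpl; unfold mult; simpl.
  simpl in *; set (q := sqrt _) in *.
  apply Rmult_eq_reg_l with (2 * x * q); [field_simplify; [nra | lra | lra] | nra].
- replace ((ellE x - ellK x) / (2 * x)) with (scal (/ (2 * x)) (minus (ellE x) (ellK x)))
    by (unfold scal, minus, plus, opp; simpl; unfold mult; simpl; field; lra).
  apply (is_RInt_scal (V := R_NormedModule)), (is_RInt_minus (V := R_NormedModule));
    apply (RInt_correct (V := R_CompleteNormedModule));
    [apply ex_RInt_modulus_E | apply ex_RInt_modulus_K]; lra.
Qed.

(* For [q = 1 - x sin^2 t] the derivative of [sin t cos t / sqrt q] is
   [(q^2 - (1 - x)) / (x q sqrt q)]. *)
Lemma is_RInt_modulus_cube (x : R) : x < 1 ->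
  is_RInt (fun t => / (1 - x * sin t ^ 2) / sqrt (1 - x * sin t ^ 2)) 0 (PI / 2)
    (ellE x / (1 - x)).
Proof.
intros Hx.
pose (w := fun t => sin t * cos t / sqrt (1 - x * sin t ^ 2)).
pose (dw := fun t => (1 - 2 * sin t ^ 2 + x * sin t ^ 4)
   / (1 - x * sin t ^ 2) / sqrt (1 - x * sin t ^ 2)).
assert (Hw : is_RInt dw 0 (PI / 2) 0).
{ replace 0 with (minus (w (PI / 2)) (w 0)) at 2.
  2: { unfold w, minus, plus, opp; simpl; rewrite sin_0, cos_PI2; unfold Rdiv; ring. }
  apply (is_RInt_derive (V := R_CompleteNormedModule)).
  - intros t _; assert (H := modulus_pos x t Hx).
    assert (Hs := sqrt_lt_R0 _ H); assert (Hq := sqrt_sqrt _ (Rlt_le _ _ H)).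
    assert (Hc : cos t * cos t = 1 - sin t * sin t)
      by (generalize (sin2_cos2 t); unfold Rsqr; lra).
    unfold w, dw; auto_derive; [modulus_side H Hs |].
    replace (1 + - (x * (sin t * (sin t * 1)))) with (1 - x * sin t ^ 2) by (simpl; ring).
    set (q := sqrt _) in *; rewrite <- Hq.
    replace (sin t ^ 4) with ((sin t ^ 2) ^ 2) by ring.
    assert (Hx2 : x * sin t ^ 2 = 1 - q * q) by lra.
    apply Rmult_eq_reg_r with (q * q * q); [| apply Rgt_not_eq; nra].
    transitivity ((cos t * cos t - sin t ^ 2) * (q * q) + (x * sin t ^ 2) * (cos t * cos t));
      [field; lra |].
    rewrite Hc; transitivity (1 - 2 * sin t ^ 2 + (x * sin t ^ 2) * sin t ^ 2);
      [rewrite Hx2; ring | field; lra].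
  - intros t _; assert (H := modulus_pos x t Hx); unfold dw; continuous_by_derive.
    assert (Hs := sqrt_lt_R0 _ H); modulus_side H Hs. }
apply is_RInt_ext with (fun t => scal (/ (1 - x))
  (minus (sqrt (1 - x * sin t ^ 2)) (scal x (dw t)))).
- intros t _; assert (H := modulus_pos x t Hx).
  assert (Hs := sqrt_lt_R0 _ H); assert (Hq := sqrt_sqrt _ (Rlt_le _ _ H)).
  unfold dw, scal, minus, plus, opp; simpl; unfold mult; simpl.
  replace (sin t * (sin t * (sin t * (sin t * 1)))) with ((sin t ^ 2) ^ 2) by ring.
  replace (sin t * (sin t * 1)) with (sin t ^ 2) by ring.
  set (q := sqrt _) in *; rewrite <- Hq.
  apply Rmult_eq_reg_r with ((1 - x) * q * q * q); [| apply Rgt_not_eq; repeat apply Rmult_lt_0_compat; lra].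
  transitivity ((q * q) * (q * q) - x * (1 - 2 * sin t ^ 2) - (x * sin t ^ 2) * (x * sin t ^ 2));
    [field; lra |].
  transitivity (1 - x); [rewrite Hq; ring | field; lra].
- replace (ellE x / (1 - x)) with (scal (/ (1 - x)) (minus (ellE x) (scal x 0)))
    by (unfold scal, minus, plus, opp; simpl; unfold mult; simpl; field; lra).
  apply (is_RInt_scal (V := R_NormedModule)), (is_RInt_minus (V := R_NormedModule)).
  + now apply (RInt_correct (V := R_CompleteNormedModule)), ex_RInt_modulus_E.
  + now apply (is_RInt_scal (V := R_NormedModule)).
Qed.

(** With q = 1 - x sin^2 t, the derivative of the integrand is (1 / (q sqrt q) - 1 / sqrt q) / (2
    x), and [is_RInt_modulus_cube] evaluates the first term. *)
Lemma is_derive_ellK (x : R) : 0 < x < 1 ->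
  is_derive ellK x ((ellE x - (1 - x) * ellK x) / (2 * x * (1 - x))).
Proof.
intros Hx.
pose (dk := fun u t => sin t ^ 2 * (/ (2 * (1 - u * sin t ^ 2) * sqrt (1 - u * sin t ^ 2)))).
replace ((ellE x - (1 - x) * ellK x) / (2 * x * (1 - x))) with (RInt (dk x) 0 (PI / 2)).
- apply (is_derive_RInt_modulus (fun u t => / sqrt (1 - u * sin t ^ 2)) dk); [lra | | |].
  + intros u t Hu; assert (H := modulus_pos u t Hu).
    assert (Hs := sqrt_lt_R0 _ H); assert (Hq := sqrt_sqrt _ (Rlt_le _ _ H)).
    unfold dk; auto_derive; [modulus_side H Hs |].
    replace (1 + - (u * (sin t * (sin t * 1)))) with (1 - u * sin t ^ 2) by (simpl; ring).
    set (q := sqrt _) in *; rewrite <- Hq; field; lra.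
  + intros u t Hu.
    apply (continuity_2d_pt_modulus_comp (fun z => / (2 * z * sqrt z)) u t Hu).
    intros z Hz; assert (Hs := sqrt_lt_R0 _ Hz).
    auto_derive; repeat split; try lra; apply Rgt_not_eq; nra.
  + intros; now apply ex_RInt_modulus_K.
- apply is_RInt_unique.
  apply is_RInt_ext with (fun t => scal (/ (2 * x))
    (minus (/ (1 - x * sin t ^ 2) / sqrt (1 - x * sin t ^ 2)) (/ sqrt (1 - x * sin t ^ 2)))).
  + intros t _; assert (H := modulus_pos x t (proj2 Hx)).
    assert (Hs := sqrt_lt_R0 _ H); assert (Hq := sqrt_sqrt _ (Rlt_le _ _ H)).
    unfold dk, scal, minus, plus, opp; simpl; unfold mult; simpl.
    replace (sin t * (sin t * 1)) with (sin t ^ 2) by ring.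
    field; lra.
  + replace ((ellE x - (1 - x) * ellK x) / (2 * x * (1 - x))) with
      (scal (/ (2 * x)) (minus (ellE x / (1 - x)) (ellK x)))
      by (unfold scal, minus, plus, opp; simpl; unfold mult; simpl; field; lra).
    apply (is_RInt_scal (V := R_NormedModule)), (is_RInt_minus (V := R_NormedModule)).
    * apply is_RInt_modulus_cube; lra.
    * apply (RInt_correct (V := R_CompleteNormedModule)), ex_RInt_modulus_K; lra.
Qed.

(** * Elementary bounds of the complete elliptic integrals *)

Lemma PI2_pos : 0 < PI / 2.
Proof. generalize PI_RGT_0; lra. Qed.

Lemma RInt_const_PI2 (a : R) : RInt (fun _ => a) 0 (PI / 2) = a * (PI / 2).
Proof. rewrite RInt_const; unfold scal; simpl; unfold mult; simpl; ring. Qed.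

Lemma sqrt_modulus_le_1 (x t : R) : 0 <= x -> sqrt (1 - x * sin t ^ 2) <= 1.
Proof.
intros Hx; assert (Hs := sin_pow2_bound t).
apply Rle_trans with (sqrt 1); [apply sqrt_le_1_alt; nra | rewrite sqrt_1; lra].
Qed.

Lemma ellK_lower (x : R) : 0 <= x < 1 -> PI / 2 <= ellK x.
Proof.
intros Hx; rewrite <- (Rmult_1_l (PI / 2)), <- RInt_const_PI2.
apply RInt_le; [left; exact PI2_pos | apply ex_RInt_const | apply ex_RInt_modulus_K; lra |].
intros t _; assert (H := modulus_pos x t (proj2 Hx)).
apply Rle_trans with (/ 1); [rewrite Rinv_1; lra |].
apply Rinv_le_contravar; [now apply sqrt_lt_R0 | now apply sqrt_modulus_le_1].
Qed.

Lemma ellE_upper (x : R) : 0 <= x < 1 -> ellE x <= PI / 2.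
Proof.
intros Hx; rewrite <- (Rmult_1_l (PI / 2)), <- RInt_const_PI2.
apply RInt_le; [left; exact PI2_pos | apply ex_RInt_modulus_E; lra | apply ex_RInt_const |].
intros t _; now apply sqrt_modulus_le_1.
Qed.

Lemma ellE_le_ellK (x : R) : 0 <= x < 1 -> ellE x <= ellK x.
Proof. intros Hx; generalize (ellE_upper x Hx) (ellK_lower x Hx); lra. Qed.

Lemma ellE_ge_ellK (x : R) : 0 <= x < 1 -> (1 - x) * ellK x <= ellE x.
Proof.
intros Hx; unfold ellK.
change ((1 - x) * RInt (fun t => / sqrt (1 - x * sin t ^ 2)) 0 (PI / 2))
  with (scal (1 - x) (RInt (fun t => / sqrt (1 - x * sin t ^ 2)) 0 (PI / 2))).
rewrite <- RInt_scal by (apply ex_RInt_modulus_K; lra).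
apply RInt_le; [left; exact PI2_pos | | apply ex_RInt_modulus_E; lra |].
- apply (ex_RInt_scal (V := R_NormedModule)), ex_RInt_modulus_K; lra.
- intros t _; assert (H := modulus_pos x t (proj2 Hx)); assert (Ht := sin_pow2_bound t).
  assert (Hs := sqrt_lt_R0 _ H); assert (Hq := sqrt_sqrt _ (Rlt_le _ _ H)).
  unfold scal; simpl; unfold mult; simpl.
  replace (sin t * (sin t * 1)) with (sin t ^ 2) by ring.
  apply Rmult_le_reg_r with (sqrt (1 - x * sin t ^ 2)); [exact Hs |].
  rewrite Hq, Rmult_assoc, Rinv_l by lra; nra.
Qed.

(** * Bounds of arth *)

Lemma mvt_is_derive (f df : R -> R) (a b : R) :
  a < b -> (forall x, a <= x <= b -> is_derive f x (df x)) ->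
  exists z, a < z < b /\ f b - f a = df z * (b - a).
Proof.
intros Hab Hd.
destruct (MVT_cor2 f df a b Hab) as [z [Hz1 Hz2]].
- intros z Hz; apply is_derive_Reals; now apply Hd.
- now exists z.
Qed.

Lemma nonneg_of_derive_nonneg (f df : R -> R) (x : R) :
  f 0 = 0 -> 0 < x ->
  (forall z, 0 <= z <= x -> is_derive f z (df z)) ->
  (forall z, 0 < z < x -> 0 <= df z) -> 0 <= f x.
Proof.
intros H0 Hx Hd Hp.
destruct (mvt_is_derive f df 0 x Hx Hd) as [z [Hz He]].
specialize (Hp z Hz); nra.
Qed.

Lemma is_derive_arth (r : R) : -1 < r < 1 -> is_derive arth r (/ (1 - r ^ 2)).
Proof.
intros Hr; unfold arth; auto_derive.
- repeat split; [lra | apply Rdiv_lt_0_compat; lra].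
- field; repeat split; nra.
Qed.

Lemma arth_0 : arth 0 = 0.
Proof. unfold arth; replace ((1 + 0) / (1 - 0)) with 1 by field; rewrite ln_1; ring. Qed.

Lemma arth_le_of_derive (h dh : R -> R) (r : R) :
  0 < r < 1 -> h 0 = 0 ->
  (forall z, 0 <= z < 1 -> is_derive h z (dh z)) ->
  (forall z, 0 < z < 1 -> / (1 - z ^ 2) <= dh z) -> arth r <= h r.
Proof.
intros Hr H0 Hd Hp.
enough (0 <= minus (h r) (arth r)) by (unfold minus, plus, opp in *; simpl in *; lra).
apply (nonneg_of_derive_nonneg (fun z => minus (h z) (arth z)) (fun z => minus (dh z) (/ (1 - z ^ 2)))).
- rewrite arth_0, H0; unfold minus, plus, opp; simpl; ring.
- lra.
- intros z Hz; apply (is_derive_minus (V := R_NormedModule));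
    [apply Hd; lra | apply is_derive_arth; lra].
- intros z Hz; specialize (Hp z); unfold minus, plus, opp in *; simpl in *; lra.
Qed.

Lemma arth_ge_of_derive (h dh : R -> R) (r : R) :
  0 < r < 1 -> h 0 = 0 ->
  (forall z, 0 <= z < 1 -> is_derive h z (dh z)) ->
  (forall z, 0 < z < 1 -> dh z <= / (1 - z ^ 2)) -> h r <= arth r.
Proof.
intros Hr H0 Hd Hp.
enough (0 <= minus (arth r) (h r)) by (unfold minus, plus, opp in *; simpl in *; lra).
apply (nonneg_of_derive_nonneg (fun z => minus (arth z) (h z)) (fun z => minus (/ (1 - z ^ 2)) (dh z))).
- rewrite arth_0, H0; unfold minus, plus, opp; simpl; ring.
- lra.
- intros z Hz; apply (is_derive_minus (V := R_NormedModule));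
    [apply is_derive_arth; lra | apply Hd; lra].
- intros z Hz; specialize (Hp z); unfold minus, plus, opp in *; simpl in *; lra.
Qed.

(* The bounds are the Padé approximants given by the Gauss and the Lobatto quadrature of
   [arth r / r = RInt (fun t => / (1 - r^2 t^2)) 0 1]. *)
Lemma arth_lower (r : R) : 0 < r < 1 ->
  r * (105 - 55 * r ^ 2) / (105 - 90 * r ^ 2 + 9 * r ^ 4) <= arth r.
Proof.
intros Hr.
(* The derivative of the approximant is written as that of [arth] minus a remainder of visible sign;
   being of Padé type, the approximant leaves a single monomial in the numerator of the
   remainder. *)
apply (arth_ge_of_derive (fun z => z * (105 - 55 * z ^ 2) / (105 - 90 * z ^ 2 + 9 * z ^ 4))
  (fun z => (/ (1 - z ^ 2)) - 576 * z ^ 8 / ((1 - z ^ 2) * (105 - 90 * z ^ 2 + 9 * z ^ 4) ^ 2))); trivial.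
- field.
- intros z Hz; assert (0 < 105 - 90 * z ^ 2 + 9 * z ^ 4) by nra.
  auto_derive; [simpl in *; lra | field; split; nra].
- intros z Hz; assert (0 < 105 - 90 * z ^ 2 + 9 * z ^ 4) by nra.
  enough (0 <= 576 * z ^ 8 / ((1 - z ^ 2) * (105 - 90 * z ^ 2 + 9 * z ^ 4) ^ 2)) by lra.
  apply Rcomplements.Rdiv_le_0_compat; [|apply Rmult_lt_0_compat; [nra | now apply pow_lt]].
  assert (0 < z ^ 8) by (apply pow_lt; lra); lra.
Qed.

Lemma arth_upper (r : R) : 0 < r < 1 ->
  arth r <= r * (315 - 420 * r ^ 2 + 113 * r ^ 4)
    / (15 * (1 - r ^ 2) * (21 - 14 * r ^ 2 + r ^ 4)).
Proof.
intros Hr.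
apply (arth_le_of_derive
  (fun z => z * (315 - 420 * z ^ 2 + 113 * z ^ 4) / (15 * (1 - z ^ 2) * (21 - 14 * z ^ 2 + z ^ 4)))
  (fun z => / (1 - z ^ 2) + 1920 * z ^ 10 / (15 * (1 - z ^ 2) * (21 - 14 * z ^ 2 + z ^ 4)) ^ 2)); trivial.
- field.
- intros z Hz; assert (0 < 21 - 14 * z ^ 2 + z ^ 4) by nra; assert (0 < 1 - z ^ 2) by nra.
  auto_derive; [| field; split; lra].
  apply Rgt_not_eq; simpl in *; repeat apply Rmult_lt_0_compat; lra.
- intros z Hz; assert (0 < 21 - 14 * z ^ 2 + z ^ 4) by nra.
  enough (0 <= 1920 * z ^ 10 / (15 * (1 - z ^ 2) * (21 - 14 * z ^ 2 + z ^ 4)) ^ 2) by lra.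
  apply Rcomplements.Rdiv_le_0_compat; [|apply pow_lt; repeat apply Rmult_lt_0_compat; nra].
  assert (0 < z ^ 10) by (apply pow_lt; lra); lra.
Qed.

(* Since [1 / (1 - r^2) = cosh (arth r)^2], this is the Taylor bound [1 + t^2 + t^4 / 3 <= cosh t ^ 2]. *)
Lemma arth_cosh_bound (r : R) : 0 < r < 1 ->
  (1 - r ^ 2) * (1 + arth r ^ 2 + arth r ^ 4 / 3) <= 1.
Proof.
intros Hr.
(* With t = arth z, z / (1 - z^2) = sinh t cosh t and z^2 / (1 - z^2) = sinh t ^ 2. The chain is t
   <= sinh t cosh t, t^2 <= sinh t ^ 2, t + 2 t^3 / 3 <= sinh t cosh t and the claim; up to the
   factor 2 / (1 - z^2), each difference is the derivative of the next. *)
assert (H1 : forall z, 0 < z < 1 -> 0 <= z / (1 - z ^ 2) - arth z).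
{ intros x Hx.
  apply (nonneg_of_derive_nonneg (fun z => z / (1 - z ^ 2) - arth z)
    (fun z => 2 * z ^ 2 / (1 - z ^ 2) ^ 2)); [rewrite arth_0; field | lra | |].
  - intros z Hz; assert (Ha := is_derive_arth z); assert (0 < 1 - z ^ 2) by nra.
    auto_derive; [repeat split; [simpl in *; lra | eexists; apply Ha; lra] |].
    replace (Derive (fun x : R => arth x) z) with (/ (1 - z ^ 2)) by
      (symmetry; apply is_derive_unique, Ha; lra); field; lra.
  - intros z Hz; apply Rcomplements.Rdiv_le_0_compat; [nra | apply pow_lt; nra]. }
assert (H2 : forall z, 0 < z < 1 -> 0 <= z ^ 2 / (1 - z ^ 2) - arth z ^ 2).
{ intros x Hx.
  apply (nonneg_of_derive_nonneg (fun z => z ^ 2 / (1 - z ^ 2) - arth z ^ 2)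
    (fun z => 2 / (1 - z ^ 2) * (z / (1 - z ^ 2) - arth z))); [rewrite arth_0; field | lra | |].
  - intros z Hz; assert (Ha := is_derive_arth z); assert (0 < 1 - z ^ 2) by nra.
    auto_derive; [repeat split; [simpl in *; lra | eexists; apply Ha; lra] |].
    replace (Derive (fun x : R => arth x) z) with (/ (1 - z ^ 2)) by
      (symmetry; apply is_derive_unique, Ha; lra); field; lra.
  - intros z Hz; apply Rmult_le_pos; [|apply H1; lra].
    apply Rcomplements.Rdiv_le_0_compat; nra. }
assert (H3 : forall z, 0 < z < 1 -> 0 <= z / (1 - z ^ 2) - arth z - 2 / 3 * arth z ^ 3).
{ intros x Hx.
  apply (nonneg_of_derive_nonneg (fun z => z / (1 - z ^ 2) - arth z - 2 / 3 * arth z ^ 3)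
    (fun z => 2 / (1 - z ^ 2) * (z ^ 2 / (1 - z ^ 2) - arth z ^ 2))); [rewrite arth_0; field | lra | |].
  - intros z Hz; assert (Ha := is_derive_arth z); assert (0 < 1 - z ^ 2) by nra.
    auto_derive; [repeat split; [simpl in *; lra | eexists; apply Ha; lra ..] |].
    replace (Derive (fun x : R => arth x) z) with (/ (1 - z ^ 2)) by
      (symmetry; apply is_derive_unique, Ha; lra); field; lra.
  - intros z Hz; apply Rmult_le_pos; [|apply H2; lra].
    apply Rcomplements.Rdiv_le_0_compat; nra. }
assert (H4 : 0 <= / (1 - r ^ 2) - 1 - arth r ^ 2 - arth r ^ 4 / 3).
{ apply (nonneg_of_derive_nonneg (fun z => / (1 - z ^ 2) - 1 - arth z ^ 2 - arth z ^ 4 / 3)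
    (fun z => 2 / (1 - z ^ 2) * (z / (1 - z ^ 2) - arth z - 2 / 3 * arth z ^ 3)));
    [rewrite arth_0; field | lra | |].
  - intros z Hz; assert (Ha := is_derive_arth z); assert (0 < 1 - z ^ 2) by nra.
    auto_derive; [repeat split; [simpl in *; lra | eexists; apply Ha; lra ..] |].
    replace (Derive (fun x : R => arth x) z) with (/ (1 - z ^ 2)) by
      (symmetry; apply is_derive_unique, Ha; lra); field; lra.
  - intros z Hz; apply Rmult_le_pos; [|apply H3; lra].
    apply Rcomplements.Rdiv_le_0_compat; nra. }
assert (Hy : 0 < 1 - r ^ 2) by nra.
apply Rmult_le_reg_l with (/ (1 - r ^ 2)); [now apply Rinv_0_lt_compat |].
rewrite <- Rmult_assoc, Rinv_l by lra; lra.
Qed.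

(* [- arth (r cos t / sqrt (1 - r^2 sin^2 t)) / r] is an antiderivative of the integrand. *)
Lemma is_RInt_sin_modulus (r : R) : 0 < r < 1 ->
  is_RInt (fun t => sin t / sqrt (1 - r ^ 2 * sin t ^ 2)) 0 (PI / 2) (arth r / r).
Proof.
intros Hr; assert (Hr2 : r ^ 2 < 1) by nra.
pose (v := fun t => r * cos t / sqrt (1 - r ^ 2 * sin t ^ 2)).
replace (arth r / r) with (minus (- arth (v (PI / 2)) / r) (- arth (v 0) / r)).
2: { unfold v, minus, plus, opp; simpl; rewrite cos_PI2, cos_0, sin_0.
  replace (1 - r * (r * 1) * (0 * (0 * 1))) with 1 by ring; rewrite sqrt_1.
  replace (r * 1 / 1) with r by field.
  unfold Rdiv at 2; rewrite Rmult_0_r, Rmult_0_l, arth_0; field; lra. }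
apply (is_RInt_derive (V := R_CompleteNormedModule) (fun t => - arth (v t) / r)).
- intros t _; assert (H := modulus_pos (r ^ 2) t Hr2).
  assert (Hs := sqrt_lt_R0 _ H); assert (Hq := sqrt_sqrt _ (Rlt_le _ _ H)).
  assert (Hc : cos t ^ 2 = 1 - sin t ^ 2)
    by (generalize (sin2_cos2 t); unfold Rsqr; simpl; lra).
  (* This identity both places [v t] in the domain of [arth] and evaluates the derivative of [arth]
     there. *)
  assert (Hv2 : 1 - v t ^ 2 = (1 - r ^ 2) / (1 - r ^ 2 * sin t ^ 2)).
  { unfold v; rewrite <- Hq at 2; set (q := sqrt _) in *.
    apply Rmult_eq_reg_r with (q * q); [| apply Rgt_not_eq; nra].
    transitivity (q * q - r ^ 2 * cos t ^ 2); [field; lra |].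
    rewrite Hq, Hc; field; lra. }
  assert (Hv1 : -1 < v t < 1).
  { assert (0 < 1 - v t ^ 2) by (rewrite Hv2; apply Rdiv_lt_0_compat; lra); nra. }
  assert (Hdv : is_derive v t (- (r * sin t * (1 - r ^ 2)) / (1 - r ^ 2 * sin t ^ 2)
     / sqrt (1 - r ^ 2 * sin t ^ 2))).
  { unfold v; auto_derive; [modulus_side H Hs |].
    replace (1 + - (r * (r * 1) * (sin t * (sin t * 1)))) with (1 - r ^ 2 * sin t ^ 2) by (simpl; ring).
    set (q := sqrt _) in *; rewrite <- Hq.
    apply Rmult_eq_reg_r with (q * q * q); [| apply Rgt_not_eq; nra].
    transitivity (- r * sin t * (q * q) + r ^ 3 * sin t * cos t ^ 2); [field; lra |].
    transitivity (- (r * sin t * (1 - r ^ 2))); [rewrite Hq, Hc; ring | field; lra]. }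
  assert (Ha := is_derive_arth (v t) Hv1).
  apply (is_derive_ext (fun t => scal (- / r) (arth (v t)))).
  { intros u; unfold scal; simpl; unfold mult; simpl; field; lra. }
  replace (sin t / _) with (scal (- / r) (scal (- (r * sin t * (1 - r ^ 2))
    / (1 - r ^ 2 * sin t ^ 2) / sqrt (1 - r ^ 2 * sin t ^ 2)) (/ (1 - v t ^ 2)))).
  + apply (is_derive_scal (fun t => arth (v t))).
    now apply (is_derive_comp (V := R_NormedModule)).
  + rewrite Hv2; unfold scal; simpl; unfold mult; simpl; simpl in *; field; repeat split; lra.
- intros t _; assert (H := modulus_pos (r ^ 2) t Hr2); continuous_by_derive.
  assert (Hs := sqrt_lt_R0 _ H); modulus_side H Hs.
Qed.

Lemma arth_le_ellK (r : R) : 0 < r < 1 -> arth r / r <= ellK (r ^ 2).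
Proof.
intros Hr; assert (Hr2 : r ^ 2 < 1) by nra.
rewrite <- (is_RInt_unique _ _ _ _ (is_RInt_sin_modulus r Hr)).
apply RInt_le; [left; exact PI2_pos | eexists; now apply is_RInt_sin_modulus
  | now apply ex_RInt_modulus_K |].
intros t _; assert (H := sqrt_lt_R0 _ (modulus_pos (r ^ 2) t Hr2)).
rewrite <- (Rmult_1_l (/ _)); apply Rmult_le_compat_r;
  [left; now apply Rinv_0_lt_compat | apply SIN_bound].
Qed.

(** The integrands of K and of arth r / r differ by (1 - sin t) / sqrt (1 - r^2 sin^2 t), which is
    at most 1 uniformly in r: the singularity of both integrands as r tends to 1 is the same. *)
Lemma ellK_le_arth (r : R) : 0 < r < 1 -> ellK (r ^ 2) <= arth r / r + PI / 2.
Proof.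
intros Hr; assert (Hr2 : r ^ 2 < 1) by nra.
assert (Hsum : is_RInt (fun t => plus (sin t / sqrt (1 - r ^ 2 * sin t ^ 2)) 1) 0 (PI / 2)
  (arth r / r + PI / 2)).
{ replace (arth r / r + PI / 2) with (plus (arth r / r) (scal (PI / 2 - 0) 1))
    by (unfold plus, scal; simpl; unfold mult; simpl; ring).
  apply (is_RInt_plus (V := R_NormedModule));
    [now apply is_RInt_sin_modulus | apply (is_RInt_const (V := R_NormedModule))]. }
rewrite <- (is_RInt_unique _ _ _ _ Hsum).
apply RInt_le; [left; exact PI2_pos | now apply ex_RInt_modulus_K
  | eexists; exact Hsum |].
intros t Ht; assert (H := modulus_pos (r ^ 2) t Hr2).
assert (Hs := sqrt_lt_R0 _ H); assert (Hq := sqrt_sqrt _ (Rlt_le _ _ H)).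
assert (Ht0 : 0 <= sin t) by (apply sin_ge_0; generalize PI_RGT_0; lra).
assert (Ht1 := SIN_bound t).
unfold plus; simpl.
apply Rmult_le_reg_r with (sqrt (1 - r ^ 2 * sin t ^ 2)); [exact Hs |].
simpl in *; set (q := sqrt _) in *.
rewrite Rinv_l by lra.
replace ((sin t / q + 1) * q) with (sin t + q) by (field; lra).
(* [(1 - sin t)^2 <= 1 - sin^2 t <= q^2] *)
destruct (Rle_dec (1 - sin t) q); [lra |].
assert (q * q < (1 - sin t) * (1 - sin t)) by nra; nra.
Qed.

(** * Polynomial inequalities *)

(** These products serve as hints: given them, [lra], with monomials as atoms, proves a polynomial
    inequality on [0, a] by finding a nonnegative combination. *)
Lemma bernstein_nonneg (x a : R) : 0 <= x <= a -> forall i j, 0 <= x ^ i * (a - x) ^ j.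
Proof. intros Hx i j; apply Rmult_le_pos; apply pow_le; lra. Qed.

(* [4 x^2 (1 - x)^2 G''(x)], in terms of [b = 1 / A - (1 - x)] and [th = E / K - (1 - x)]. *)
Definition curv (c x b th : R) : R :=
  x * (1 - x) / 2 + 2 * c * x ^ 2 * (1 - x) - 3 / 4 * b * (b + 3 - 5 * x)
  + c * x * b * (1 + x - b) + th ^ 2 + 2 * (1 - 2 * x) * th.

(** All that is used of arth, as polynomial constraints on the number b = 1 / A - (1 - x): the upper
    bound of arth gives the lower bound of b and conversely, and in [cosh_bound] b + (1 - x) stands
    for 1 / A. *)
Definition pade_lower (x b : R) : Prop :=
  14 * x * (1 - x) * (15 - 7 * x) <= b * (315 - 420 * x + 113 * x ^ 2).
Definition pade_upper (x b : R) : Prop :=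
  b * (105 - 55 * x) <= x * (70 - 46 * x).
Definition cosh_bound (x b : R) : Prop :=
  (1 - x) * (x ^ 2 / 3 + x * (b + (1 - x)) ^ 2) <= (b + (1 - x)) ^ 4.

(** For T = 1 / A^2 the hypothesis says T (T - x (1 - x)) >= (1 - x) x^2 / 3. If T were below 29 /
    10 (1 - x), the left side would be of order (1 - x)^2, too small once 1 - x <= 1 / 20. *)
Lemma cosh_square_lower (x b : R) : 19 / 20 <= x < 1 -> cosh_bound x b ->
  29 / 10 * (1 - x) <= (b + (1 - x)) ^ 2.
Proof.
unfold cosh_bound; intros Hx H.
replace ((b + (1 - x)) ^ 4) with (((b + (1 - x)) ^ 2) ^ 2) in H by ring.
assert (HT := pow2_ge_0 (b + (1 - x))); set (T := (b + (1 - x)) ^ 2) in *.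
apply Rnot_lt_le; intros Hlt.
assert (H1 : T * (T - x * (1 - x)) <= 29 / 10 * (1 - x) * (29 / 10 * (1 - x) - x * (1 - x))).
{ destruct (Rle_dec 0 (T - x * (1 - x))); [| nra].
  apply Rmult_le_compat; lra. }
assert (H2 : (1 - x) * (x ^ 2 / 3) <= (1 - x) * (29 / 10 * (29 / 10 - x) * (1 - x))) by nra.
apply Rmult_le_reg_l in H2; [nra | lra].
Qed.

Lemma lower_poly_pos (x : R) : 0 < x < 1 -> 0 < 315 - 420 * x + 113 * x ^ 2.
Proof. nra. Qed.

(** A concave quadratic in b whose slope is nonpositive at the lower bound of b decreases from there
    on, so it is enough that it be negative there; the last two hypotheses are these conditions with
    the denominator cleared. *)
Lemma quad_neg_of_lower_gen (x b p q r : R) :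
  0 < x < 1 -> pade_lower x b -> r <= 0 ->
  q * (315 - 420 * x + 113 * x ^ 2) + 2 * r * (14 * x * (1 - x) * (15 - 7 * x)) <= 0 ->
  p * (315 - 420 * x + 113 * x ^ 2) ^ 2
  + q * (14 * x * (1 - x) * (15 - 7 * x)) * (315 - 420 * x + 113 * x ^ 2)
  + r * (14 * x * (1 - x) * (15 - 7 * x)) ^ 2 < 0 ->
  p + q * b + r * b ^ 2 < 0.
Proof.
intros Hx HL Hr Hq Hneg; assert (HD := lower_poly_pos x Hx); unfold pade_lower in HL.
set (D := 315 - 420 * x + 113 * x ^ 2) in *.
set (n := 14 * x * (1 - x) * (15 - 7 * x)) in *.
apply Rmult_lt_reg_r with (D ^ 2); [now apply pow_lt |].
(* [D^2 (p + q b + r b^2) = (p D^2 + q n D + r n^2) + (b D - n) (q D + 2 r n) + r (b D - n)^2] *)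
assert (H1 : 0 <= (b * D - n) * (- (q * D + 2 * r * n))) by (apply Rmult_le_pos; lra).
assert (H2 : 0 <= - r * (b * D - n) ^ 2) by (apply Rmult_le_pos; [lra | apply pow2_ge_0]).
nra.
Qed.

Lemma quad_neg_of_lower (x b p q r : R) :
  0 < x < 1 -> pade_lower x b -> q <= 0 -> r <= 0 ->
  p * (315 - 420 * x + 113 * x ^ 2) ^ 2
  + q * (14 * x * (1 - x) * (15 - 7 * x)) * (315 - 420 * x + 113 * x ^ 2)
  + r * (14 * x * (1 - x) * (15 - 7 * x)) ^ 2 < 0 ->
  p + q * b + r * b ^ 2 < 0.
Proof.
intros Hx HL Hq Hr; apply quad_neg_of_lower_gen; trivial.
assert (HD := lower_poly_pos x Hx).
assert (Hn : 0 <= 14 * x * (1 - x) * (15 - 7 * x)) by (repeat apply Rmult_le_pos; lra).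
nra.
Qed.

(* Below, polynomials with large coefficients arise from substituting for [b] (or [th]) its bound and
   clearing denominators; they are positive since their Bernstein coefficients are. *)
Lemma lower_barrier_poly (x b : R) :
  0 < x < 1 -> 0 < b -> pade_lower x b -> cosh_bound x b ->
  let k := 3 / 4 + x / 200 in
  (1 / 100 * b + 2 * k - 1) * (x * (1 - x)) - k * (1 - x) * b - k * (1 - k) * b ^ 2 < 0.
Proof.
intros Hx Hb HL HB k.
(* For s = k b the claim reads 2 x (1 - x) s' < x (1 - x) - s^2: s is a strict subsolution of the
   equation of th. *)
replace (_ - _ - _) with ((2 * k - 1) * (x * (1 - x)) + (x / 100 - k) * (1 - x) * b
   + - (k * (1 - k)) * b ^ 2) by field.
assert (Hk : 3 / 4 <= k <= 151 / 200) by (unfold k; lra).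
(* The Padé lower bound vanishes linearly at x = 1, much faster than b; beyond 19 / 20 the cosh
   bound replaces it. *)
destruct (Rle_dec x (19 / 20)) as [Hx1 | Hx1].
- apply (quad_neg_of_lower x); trivial; try nra.
  assert (HR : 0 < (1323 / 4) + (8253 / 5) * x + (-1271361 / 400) * x ^ 2
    + (2648983 / 2000) * x ^ 3 + (-1603191 / 10000) * x ^ 4 + (2401 / 10000) * x ^ 5).
  { assert (H := bernstein_nonneg x (19 / 20) ltac:(lra)).
    generalize (H 0%nat 5%nat) (H 1%nat 4%nat) (H 2%nat 3%nat) (H 3%nat 2%nat)
      (H 4%nat 1%nat) (H 5%nat 0%nat); lra. }
  set (R2 := _ + _ * x ^ 5) in HR.
  replace (_ + _ + _) with (- (x ^ 2 * (1 - x) * R2)) by (unfold R2, k; field).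
  assert (0 < x ^ 2 * (1 - x) * R2) by (repeat apply Rmult_lt_0_compat; try apply pow_lt; lra).
  lra.
- assert (HT := cosh_square_lower x b ltac:(lra) HB).
  assert (Hy : 0 < 1 - x <= 1 / 20) by lra.
  set (y := 1 - x) in *.
  replace x with (1 - y) by (unfold y; ring).
  assert (b + y >= 3 / 2 * y) by nra.
  assert (b ^ 2 >= 29 / 10 * y - 2 * y * b - y ^ 2) by nra.
  (* The margin: 18 / 100 times 29 / 10 is 522 / 1000, which exceeds 2 k - 1 <= 51 / 100. *)
  assert (k * (1 - k) >= 18 / 100) by nra.
  nra.
Qed.

(** At th = k b, [curv] is a concave quadratic in b. At x = 1 its linear coefficient is 2 (3 / 4 + 1
    / 320) - 2 k, negative because 1 / 200 > 1 / 320. *)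
Lemma curv_neg_at_lower (x b : R) :
  0 < x < 1 -> 0 < b -> pade_lower x b -> cosh_bound x b ->
  curv (1 / 320) x b ((3 / 4 + x / 200) * b) < 0.
Proof.
intros Hx Hb HL HB; set (k := 3 / 4 + x / 200).
assert (Hk : 3 / 4 <= k <= 151 / 200) by (unfold k; lra).
assert (Hq : - (3 / 4) * (3 - 5 * x) + x * (1 + x) / 320 + 2 * (1 - 2 * x) * k <= 0)
  by (unfold k; nra).
assert (Hr : - (3 / 4) - x / 320 + k ^ 2 <= - (18 / 100)) by (unfold k; nra).
replace (curv _ _ _ _) with (x * (1 - x) / 2 + x ^ 2 * (1 - x) / 160
  + (- (3 / 4) * (3 - 5 * x) + x * (1 + x) / 320 + 2 * (1 - 2 * x) * k) * b
  + (- (3 / 4) - x / 320 + k ^ 2) * b ^ 2) by (unfold curv; field).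
destruct (Rle_dec x (19 / 20)) as [Hx1 | Hx1].
- apply (quad_neg_of_lower x); trivial; try lra.
  assert (HR : 0 < (1323 / 8) + (186291 / 80) * x + (-806253 / 200) * x ^ 2
    + (216738 / 125) * x ^ 3 + (-564829 / 2500) * x ^ 4 + (2401 / 10000) * x ^ 5).
  { assert (H := bernstein_nonneg x (19 / 20) ltac:(lra)).
    generalize (H 0%nat 5%nat) (H 1%nat 4%nat) (H 2%nat 3%nat) (H 3%nat 2%nat)
      (H 4%nat 1%nat) (H 5%nat 0%nat); lra. }
  set (R3 := _ + _ * x ^ 5) in HR.
  replace (_ + _ + _) with (- (x ^ 2 * (1 - x) * R3)) by (unfold R3, k; field).
  assert (0 < x ^ 2 * (1 - x) * R3) by (repeat apply Rmult_lt_0_compat; try apply pow_lt; lra).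
  lra.
- assert (HT := cosh_square_lower x b ltac:(lra) HB).
  assert (Hy : 0 < 1 - x <= 1 / 20) by lra.
  assert (Hq' : - (3 / 4) * (3 - 5 * x) + x * (1 + x) / 320 + 2 * (1 - 2 * x) * k
    <= - (72 / 100) * (1 - x)) by (unfold k; nra).
  assert (Hp : x * (1 - x) / 2 + x ^ 2 * (1 - x) / 160 <= 507 / 1000 * (1 - x)).
  { assert (x ^ 2 <= 1) by nra; nra. }
  assert (b + (1 - x) >= 3 / 2 * (1 - x)) by nra.
  apply Rle_lt_trans with (507 / 1000 * (1 - x) - 72 / 100 * (1 - x) * b - 18 / 100 * b ^ 2); nra.
Qed.

(** The value given to th is 1 / (1 / b + 1 / (2 x) + 1 / 20) with b replaced by its Padé upper
    bound; this expression increases with b, so it still bounds th from above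
    ([upper_barrier_scaled]). *)
Lemma curv_neg_at_upper (x b : R) :
  0 < x <= 13 / 20 -> 0 < b -> pade_lower x b ->
  curv (1 / 320) x b (x * (70 - 46 * x) / (140 - 149 / 2 * x - 23 / 10 * x ^ 2)) < 0.
Proof.
intros Hx Hb HL.
assert (Ht : 0 < 140 - 149 / 2 * x - 23 / 10 * x ^ 2) by nra.
assert (Ht' := Ht); set (td := 140 - 149 / 2 * x - 23 / 10 * x ^ 2) in Ht' |- *.
set (th := x * (70 - 46 * x) / td).
replace (curv _ _ _ _) with (x * (1 - x) / 2 + x ^ 2 * (1 - x) / 160 + th ^ 2 + 2 * (1 - 2 * x) * th
  + (- (3 / 4) * (3 - 5 * x) + x * (1 + x) / 320) * b
  + (- (3 / 4) - x / 320) * b ^ 2) by (unfold curv; field).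
apply (quad_neg_of_lower_gen x); [lra | exact HL | lra | nra |].
assert (HR : 0 < (63051975 / 4) + (-901598775 / 32) * x + (-908358479 / 64) * x ^ 2
  + (717257597 / 10) * x ^ 3 + (-106891618581 / 1600) * x ^ 4 + (19896630269 / 800) * x ^ 5
  + (-23214521637 / 8000) * x ^ 6 + (-251025979 / 2000) * x ^ 7 + (3182993 / 8000) * x ^ 8).
{ assert (H := bernstein_nonneg x (13 / 20) ltac:(lra)).
  generalize (H 0%nat 5%nat) (H 1%nat 4%nat) (H 2%nat 3%nat) (H 3%nat 2%nat) (H 4%nat 1%nat)
    (H 5%nat 0%nat) (H 5%nat 1%nat) (H 6%nat 1%nat) (H 8%nat 0%nat); lra. }
set (R4 := _ + _ * x ^ 8) in HR.
(* The factor x^3 reflects the degeneracy at c = 1 / 320: the terms of order x and x^2 cancel. *)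
replace (_ + _ + _) with (- (x ^ 3 * R4 / td ^ 2)) by (unfold R4, th, td; field; lra).
assert (0 < x ^ 3 * R4 / td ^ 2)
  by (apply Rdiv_lt_0_compat; [apply Rmult_lt_0_compat |]; trivial; apply pow_lt; lra).
lra.
Qed.

Lemma upper_barrier_scaled (x b th : R) :
  0 < x < 1 -> pade_upper x b -> 0 <= th <= x ->
  th * (20 * x + 10 * b + x * b) <= 20 * x * b ->
  th <= x * (70 - 46 * x) / (140 - 149 / 2 * x - 23 / 10 * x ^ 2).
Proof.
unfold pade_upper; intros Hx HU Ht H.
assert (Htd : 0 < 140 - 149 / 2 * x - 23 / 10 * x ^ 2) by nra.
apply Rmult_le_reg_r with (140 - 149 / 2 * x - 23 / 10 * x ^ 2); [exact Htd |].
replace (x * (70 - 46 * x) / _ * _) with (x * (70 - 46 * x)) by (field; lra).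
assert (H1 : th * 20 * x * (105 - 55 * x) <= b * (105 - 55 * x) * (20 * x - th * (10 + x))) by nra.
assert (H2 : 0 <= 20 * x - th * (10 + x)) by nra.
assert (H3 : b * (105 - 55 * x) * (20 * x - th * (10 + x))
  <= x * (70 - 46 * x) * (20 * x - th * (10 + x))) by (apply Rmult_le_compat_r; lra).
apply Rmult_le_reg_l with (20 * x); [lra | nra].
Qed.

(** [curv] is convex in th with minimum at th = 2 x - 1, hence maximal at the lower bound of th on
    the left of this point and at the upper bound on the right. The latter case forces x <= 13 / 20,
    since beyond it the upper bound lies below 2 x - 1. *)
Lemma curv_neg (x b th : R) :
  0 < x < 1 -> 0 < b -> pade_lower x b -> pade_upper x b -> cosh_bound x b -> 0 <= th <= x ->
  (3 / 4 + x / 200) * b <= th -> th * (20 * x + 10 * b + x * b) <= 20 * x * b ->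
  curv (1 / 320) x b th < 0.
Proof.
intros Hx Hb HL HU HB Ht H1 H2.
assert (HS := upper_barrier_scaled x b th Hx HU Ht H2).
destruct (Rle_dec th (2 * x - 1)) as [Hc | Hc].
- apply Rle_lt_trans with (2 := curv_neg_at_lower x b Hx Hb HL HB).
  unfold curv; set (s := (3 / 4 + x / 200) * b) in *; nra.
- assert (Hx2 : x <= 13 / 20).
  { apply Rnot_lt_le; intros Hx1; apply Hc, (Rle_trans _ _ _ HS).
    assert (Htd : 0 < 140 - 149 / 2 * x - 23 / 10 * x ^ 2) by nra.
    apply Rmult_le_reg_r with (140 - 149 / 2 * x - 23 / 10 * x ^ 2); [exact Htd |].
    replace (x * (70 - 46 * x) / _ * _) with (x * (70 - 46 * x)) by (field; lra); nra. }
  apply Rle_lt_trans with (2 := curv_neg_at_upper x b (conj (proj1 Hx) Hx2) Hb HL).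
  unfold curv; set (s := x * (70 - 46 * x) / _) in *; nra.
Qed.

Lemma curv_pos (x b th : R) :
  0 < x < 1 -> 0 < b -> pade_upper x b ->
  3 / 4 * b <= th -> th * (2 * x + b) <= 2 * x * b ->
  0 < curv (1 / 4) x b th.
Proof.
unfold pade_upper; intros Hx Hb HU H1 H2.
assert (Hb1 : b <= 2 / 3 * x) by nra.
destruct (Rle_dec x (1 / 2)) as [Hx1 | Hx1].
- (* [curv] increases in [th] from [th = 3 / 4 * b] on. *)
  assert (0 <= (th - 3 / 4 * b) * (th + 3 / 4 * b + 2 - 4 * x)) by (apply Rmult_le_pos; lra).
  assert (0 <= (1 - x) * (x / 2 - 3 / 4 * b)) by (apply Rmult_le_pos; lra).
  assert (0 < x * (x * (1 - x) / 2 + b * (1 + x - b) / 4) - 3 / 16 * b ^ 2) by nra.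
  unfold curv; nra.
- destruct (Rle_dec x (2 / 3)) as [Hx2 | Hx2].
  + assert (Hb2 : b <= x / 2 + 3 / 50) by nra.
    (* Here the minimum over th, at th = 2 x - 1, is already positive: completing the square
       eliminates th. *)
    assert (0 <= (th + 1 - 2 * x) ^ 2) by apply pow2_ge_0.
    enough (0 < x * (1 - x) / 2 + 2 * (1 / 4) * x ^ 2 * (1 - x) - 3 / 4 * b * (b + 3 - 5 * x)
      + 1 / 4 * x * b * (1 + x - b) - (1 - 2 * x) ^ 2) by (unfold curv; nra).
    assert (0 <= (x - 1 / 2) * (2 / 3 - x)) by (apply Rmult_le_pos; lra).
    assert (Hm : b * (9 / 4 - 15 / 4 * x - x * (1 + x) / 4) + (3 / 4 + x / 4) * b ^ 2
      < x * (1 - x) / 2 + x ^ 2 * (1 - x) / 2 - (1 - 2 * x) ^ 2).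
    (* Since b^2 <= b bm, the left side is at most b M, hence at most the larger of 0 and bm M. *)
    { set (bm := x / 2 + 3 / 50) in *.
      assert (HR : 0 < x * (1 - x) / 2 + x ^ 2 * (1 - x) / 2 - (1 - 2 * x) ^ 2) by nra.
      set (M := 9 / 4 - 15 / 4 * x - x * (1 + x) / 4 + (3 / 4 + x / 4) * bm).
      assert (HM : bm * M < x * (1 - x) / 2 + x ^ 2 * (1 - x) / 2 - (1 - 2 * x) ^ 2)
        by (unfold M, bm; nra).
      assert (Hb3 : b ^ 2 <= b * bm) by nra.
      apply Rle_lt_trans with (b * M); [unfold M; nra |].
      destruct (Rle_dec 0 M); nra. }
    lra.
  + assert (Hb2 : b <= 12 / 25) by nra.
    assert (Hg : b ^ 2 <= (b - th) * (2 * x + b)) by nra.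
    (* From th <= b <= 12 / 25 follow 2 x + b <= 248 / 100 and 2 - b - th >= 104 / 100. *)
    assert (Hg2 : 104 / 248 * b ^ 2 <= (b - th) * (2 - b - th)).
    { assert (0 <= b - th) by nra.
      assert (b ^ 2 <= (b - th) * (248 / 100)) by nra.
      assert ((b - th) * (104 / 100) <= (b - th) * (2 - b - th)) by nra.
      lra. }
    assert (0 <= (1 - x) * (th - 3 / 4 * b)) by (apply Rmult_le_pos; lra).
    assert (0 <= (1 - x) ^ 2 * b) by (apply Rmult_le_pos; [apply pow2_ge_0 | lra]).
    assert (0 <= (1 - x) * b ^ 2) by (apply Rmult_le_pos; [lra | apply pow2_ge_0]).
    (* At x = 1 only (b - th) (2 - b - th) survives, because 3 / 4 + c = 1; all other terms carry
       the factor 1 - x. *)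
    replace (curv _ _ _ _) with ((b - th) * (2 - b - th) + x * (1 - x) * (1 + x) / 2
      - 9 / 2 * (1 - x) * b + 4 * (1 - x) * th + (1 - x) ^ 2 * b / 4 + (1 - x) * b ^ 2 / 4)
      by (unfold curv; field).
    assert (Hxx : 5 / 9 * (1 - x) < x * (1 - x) * (1 + x) / 2).
    { assert (0 < (1 - x) * (x * (1 + x) - 10 / 9)) by (apply Rmult_lt_0_compat; nra); lra. }
    assert (0 < 104 / 248 * b ^ 2 - 3 / 2 * (1 - x) * b + 5 / 9 * (1 - x)).
    { set (y := 1 - x) in *; assert (0 < y <= 1 / 3) by (unfold y; lra).
      (* 93 / 52 y is the vertex of the quadratic in b. *)
      assert (0 <= (b - 93 / 52 * y) ^ 2) by apply pow2_ge_0.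
      assert (y ^ 2 <= y / 3) by nra.
      lra. }
    lra.
Qed.

(** For s = 1 / (1 / b + 1 / (2 x) + 1 / 20) the square on the left is (x b / s)^2, and the claim is
    the supersolution inequality s' >= 1 / 2 - s^2 / (2 x (1 - x)) multiplied by it. *)
Lemma upper_barrier_poly (x b : R) : 0 < x < 1 -> 0 < b -> pade_upper x b ->
  (x + b / 2 + x * b / 20) ^ 2 / 2 <= x ^ 2 - x * b / 2 + b ^ 2 / 2.
Proof.
unfold pade_upper; intros Hx Hb HU.
set (d := 105 - 55 * x) in *; set (n := x * (70 - 46 * x)) in *.
assert (Hd : 0 < d) by (unfold d; lra).
set (q := - x * (1 + x / 20)); set (r := 3 / 8 - x / 40 - x ^ 2 / 800).
assert (Hr : 0 < r < 3 / 8) by (unfold r; nra).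
(* [d^2 (x^2 / 2 + q b + r b^2)] is the sum of its value at [b = n / d] and the two terms below. *)
assert (H1 : 0 <= (n - b * d) * - (q * d + 2 * r * n)).
{ apply Rmult_le_pos; [lra |].
  assert (n <= 2 / 3 * x * d) by (unfold n, d; nra).
  assert (0 < n) by (unfold n; nra).
  assert (2 * r * n <= 3 / 4 * (2 / 3 * x * d)) by nra.
  assert (q * d <= - x * d) by (unfold q; nra).
  nra. }
assert (H2 : 0 <= r * (n - b * d) ^ 2) by (apply Rmult_le_pos; [lra | apply pow2_ge_0]).
(* The orders x^2 and x^3 cancel, the latter thanks to the constant 1 / 20. *)
assert (H3 : 0 <= d ^ 2 * (x ^ 2 / 2) + q * n * d + r * n ^ 2).
{ replace (_ + _ + _) with (x ^ 4 * (2919 / 8 - 3427 / 20 * x - 529 / 200 * x ^ 2))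
    by (unfold q, r, n, d; field).
  apply Rmult_le_pos; [apply pow_le; lra | nra]. }
enough (0 <= x ^ 2 / 2 + q * b + r * b ^ 2) by (unfold q, r in *; lra).
apply Rmult_le_reg_l with (d ^ 2); [now apply pow_lt |]; nra.
Qed.

(** * The two Riccati equations and the barriers *)

Lemma is_derive_continuity_pt (f : R -> R) (x l : R) : is_derive f x l -> continuity_pt f x.
Proof.
intros H; apply derivable_continuous_pt, ex_derive_Reals_0; now exists l.
Qed.

(* Below a negative level [d] can only increase, so it cannot come down from the boundary value [0]. *)
Lemma nonneg_of_derive_where_neg (d d' : R -> R) :
  (forall x, 0 < x < 1 -> is_derive d x (d' x)) ->
  (forall x, 0 < x < 1 -> d x < 0 -> 0 <= d' x) ->
  (forall eps, 0 < eps -> exists x0, 0 < x0 /\ forall x, 0 < x < x0 -> - eps <= d x) ->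
  forall x, 0 < x < 1 -> 0 <= d x.
Proof.
intros Hd Hp H0 x1 Hx1; apply Rnot_lt_le; intros Hneg.
destruct (H0 (- d x1 / 2) ltac:(lra)) as [x0 [Hx0 Hlow]].
set (a := Rmin (x0 / 2) (x1 / 2)).
assert (Ha : 0 < a < x1 /\ a < x0).
{ unfold a; generalize (Rmin_l (x0 / 2) (x1 / 2)) (Rmin_r (x0 / 2) (x1 / 2));
    assert (0 < Rmin (x0 / 2) (x1 / 2)) by (apply Rmin_glb_lt; lra); lra. }
set (m := d x1 / 2).
assert (Hda : m <= d a) by (generalize (Hlow a ltac:(lra)); unfold m; lra).
(* The supremum z of S is the last point of [a, x1] where d >= m. On (z, x1) d < m < 0, so d does
   not decrease there, although d x1 = 2 m < m. *)
set (S := fun x => a <= x <= x1 /\ m <= d x).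
destruct (completeness S) as [z [Hz1 Hz2]].
{ exists x1; intros x [Hx _]; lra. }
{ exists a; split; [lra | exact Hda]. }
assert (Haz : a <= z) by (apply Hz1; split; [lra | exact Hda]).
assert (Hzx : z <= x1) by (apply Hz2; intros x [Hx _]; lra).
assert (Hdz : m <= d z).
{ apply Rnot_lt_le; intros Hlt.
  assert (Hc : continuity_pt d z) by (apply is_derive_continuity_pt with (d' z), Hd; lra).
  destruct (Hc (m - d z) ltac:(lra)) as [al [Hal Hcl]].
  enough (z <= z - al) by lra.
  apply Hz2; intros x [Hx Hmx]; apply Rnot_lt_le; intros Hlx.
  assert (Hxz : x <= z) by (apply Hz1; split; trivial).
  destruct (Req_dec x z) as [-> | Hne]; [lra |].
  assert (H := Hcl x); simpl in H; unfold R_dist in H.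
  assert (Rabs (d x - d z) < m - d z).
  { apply H; repeat split; [lra | apply Rabs_def1; lra]. }
  generalize (Rle_abs (d x - d z)); lra. }
assert (Hzlt : z < x1).
{ destruct Hzx as [| ->]; trivial; unfold m in Hdz; lra. }
destruct (mvt_is_derive d d' z x1 Hzlt) as [w [Hw He]]; [intros; apply Hd; lra |].
assert (Hdw : d w < m).
{ apply Rnot_le_lt; intros Hle; enough (w <= z) by lra; apply Hz1; split; lra. }
assert (0 <= d' w) by (apply Hp; [lra | unfold m in Hdw; lra]).
assert (0 <= d' w * (x1 - z)) by (apply Rmult_le_pos; lra).
unfold m in Hdz; lra.
Qed.

Definition arthq (x : R) : R := arth (sqrt x) / sqrt x.
Definition beta (x : R) : R := / arthq x - (1 - x).
Definition theta (x : R) : R := ellE x / ellK x - (1 - x).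

Lemma sqrt_unit (x : R) : 0 < x < 1 -> 0 < sqrt x < 1.
Proof.
intros Hx; split; [apply sqrt_lt_R0; lra |].
rewrite <- sqrt_1; apply sqrt_lt_1_alt; lra.
Qed.

Lemma arthq_lower (x : R) : 0 < x < 1 ->
  (105 - 55 * x) / (105 - 90 * x + 9 * x ^ 2) <= arthq x.
Proof.
intros Hx; assert (Hs := sqrt_unit x Hx); assert (Hq := pow2_sqrt x (Rlt_le _ _ (proj1 Hx))).
assert (H := arth_lower (sqrt x) Hs).
replace (sqrt x ^ 4) with ((sqrt x ^ 2) ^ 2) in H by ring; rewrite Hq in H.
unfold arthq; apply Rmult_le_reg_r with (sqrt x); [lra |].
replace (arth (sqrt x) / sqrt x * sqrt x) with (arth (sqrt x)) by (field; lra).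
eapply Rle_trans; [right | exact H]; field; nra.
Qed.

Lemma arthq_upper (x : R) : 0 < x < 1 ->
  arthq x <= (315 - 420 * x + 113 * x ^ 2) / (15 * (1 - x) * (21 - 14 * x + x ^ 2)).
Proof.
intros Hx; assert (Hs := sqrt_unit x Hx); assert (Hq := pow2_sqrt x (Rlt_le _ _ (proj1 Hx))).
assert (H := arth_upper (sqrt x) Hs).
replace (sqrt x ^ 4) with ((sqrt x ^ 2) ^ 2) in H by ring; rewrite Hq in H.
unfold arthq; apply Rmult_le_reg_r with (sqrt x); [lra |].
replace (arth (sqrt x) / sqrt x * sqrt x) with (arth (sqrt x)) by (field; lra).
eapply Rle_trans; [exact H | right]; field; nra.
Qed.

Lemma arthq_gt_1 (x : R) : 0 < x < 1 -> 1 < arthq x.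
Proof.
intros Hx; apply Rlt_le_trans with (2 := arthq_lower x Hx).
assert (0 < 105 - 90 * x + 9 * x ^ 2) by nra.
apply Rmult_lt_reg_r with (105 - 90 * x + 9 * x ^ 2); [trivial |].
replace (_ / _ * _) with (105 - 55 * x) by (field; lra); nra.
Qed.

Lemma beta_upper (x : R) : 0 < x < 1 -> pade_upper x (beta x).
Proof.
intros Hx; assert (H := arthq_lower x Hx); assert (HA := arthq_gt_1 x Hx).
assert (0 < 105 - 90 * x + 9 * x ^ 2) by nra.
unfold pade_upper, beta.
enough (/ arthq x * (105 - 55 * x) <= 105 - 90 * x + 9 * x ^ 2) by nra.
apply Rmult_le_reg_l with (arthq x); [lra |].
replace (arthq x * (/ arthq x * (105 - 55 * x))) with (105 - 55 * x) by (field; lra).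
apply Rmult_le_compat_r with (r := 105 - 90 * x + 9 * x ^ 2) in H; [| lra].
replace (_ / _ * _) with (105 - 55 * x) in H by (field; lra); lra.
Qed.

Lemma beta_lower (x : R) : 0 < x < 1 -> pade_lower x (beta x).
Proof.
intros Hx; assert (H := arthq_upper x Hx); assert (HA := arthq_gt_1 x Hx).
assert (HD := lower_poly_pos x Hx).
assert (HQ : 0 < 21 - 14 * x + x ^ 2) by nra.
unfold pade_lower, beta.
enough (15 * (1 - x) * (21 - 14 * x + x ^ 2) <= / arthq x * (315 - 420 * x + 113 * x ^ 2)) by nra.
apply Rmult_le_reg_l with (arthq x); [lra |].
replace (arthq x * (/ arthq x * (315 - 420 * x + 113 * x ^ 2))) with
  (315 - 420 * x + 113 * x ^ 2) by (field; lra).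
assert (HP : 0 < 15 * (1 - x) * (21 - 14 * x + x ^ 2)) by (repeat apply Rmult_lt_0_compat; lra).
apply Rmult_le_compat_r with (r := 15 * (1 - x) * (21 - 14 * x + x ^ 2)) in H; [| lra].
replace (_ / _ * _) with (315 - 420 * x + 113 * x ^ 2) in H by (field; lra); lra.
Qed.

Lemma beta_pos (x : R) : 0 < x < 1 -> 0 < beta x.
Proof.
intros Hx; assert (H := beta_lower x Hx); assert (HD := lower_poly_pos x Hx).
unfold pade_lower in H.
assert (0 < 14 * x * (1 - x) * (15 - 7 * x)) by (repeat apply Rmult_lt_0_compat; lra).
apply Rmult_lt_reg_r with (315 - 420 * x + 113 * x ^ 2); lra.
Qed.

Lemma arthq_cosh (x : R) : 0 < x < 1 ->
  (1 - x) * (1 + x * arthq x ^ 2 + x ^ 2 * arthq x ^ 4 / 3) <= 1.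
Proof.
intros Hx; assert (Hs := sqrt_unit x Hx); assert (Hq := pow2_sqrt x (Rlt_le _ _ (proj1 Hx))).
assert (H := arth_cosh_bound (sqrt x) Hs).
replace (arth (sqrt x)) with (arthq x * sqrt x) in H by (unfold arthq; field; lra).
replace ((arthq x * sqrt x) ^ 4) with (arthq x ^ 4 * (sqrt x ^ 2) ^ 2) in H by ring.
rewrite Rpow_mult_distr, Hq in H; lra.
Qed.

Lemma beta_cosh (x : R) : 0 < x < 1 -> cosh_bound x (beta x).
Proof.
intros Hx; assert (H := arthq_cosh x Hx); assert (HA := arthq_gt_1 x Hx).
unfold cosh_bound, beta; replace (/ arthq x - (1 - x) + (1 - x)) with (/ arthq x) by ring.
set (A := arthq x) in *.
assert (HA4 : 0 < A ^ 4) by (apply pow_lt; lra).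
apply Rmult_le_reg_r with (A ^ 4); [trivial |].
replace ((/ A) ^ 4 * A ^ 4) with 1 by (field; lra).
replace ((1 - x) * (x ^ 2 / 3 + x * (/ A) ^ 2) * A ^ 4) with
  ((1 - x) * (x * A ^ 2 + x ^ 2 * A ^ 4 / 3)) by (field; lra).
nra.
Qed.

Lemma is_derive_arthq (x : R) : 0 < x < 1 ->
  is_derive arthq x ((/ (1 - x) - arthq x) / (2 * x)).
Proof.
intros Hx; assert (Hs := sqrt_unit x Hx); assert (Hq := pow2_sqrt x (Rlt_le _ _ (proj1 Hx))).
assert (Ha := is_derive_arth (sqrt x) ltac:(lra)); rewrite Hq in Ha.
unfold arthq; auto_derive.
- repeat split; try lra; eexists; exact Ha.
- replace (Derive (fun x0 : R => arth x0) (sqrt x)) with (/ (1 - x))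
    by (symmetry; now apply is_derive_unique).
  set (s := sqrt x) in *; clearbody s; rewrite <- Hq; field; rewrite Hq; lra.
Qed.

Lemma is_derive_beta (x : R) : 0 < x < 1 ->
  is_derive beta x (1 - (beta x + (1 - x)) * beta x / (2 * x * (1 - x))).
Proof.
intros Hx; assert (HA := arthq_gt_1 x Hx); assert (Hd := is_derive_arthq x Hx).
unfold beta; auto_derive.
- repeat split; [now eexists; apply Hd | lra].
- replace (Derive (fun x0 : R => arthq x0) x) with ((/ (1 - x) - arthq x) / (2 * x))
    by (symmetry; now apply is_derive_unique).
  field; lra.
Qed.

Lemma ellK_pos (x : R) : 0 < x < 1 -> 0 < ellK x.
Proof. intros Hx; generalize (ellK_lower x ltac:(lra)) PI2_pos; lra. Qed.

Lemma theta_bounds (x : R) : 0 < x < 1 -> 0 <= theta x <= x.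
Proof.
intros Hx; assert (HK := ellK_pos x Hx); unfold theta.
assert (H1 := ellE_le_ellK x ltac:(lra)); assert (H2 := ellE_ge_ellK x ltac:(lra)).
replace (ellE x) with (ellE x / ellK x * ellK x) in H1, H2 by (field; lra).
split.
- apply Rmult_le_reg_r in H2; lra.
- enough (ellE x / ellK x <= 1) by lra.
  apply Rmult_le_reg_r with (ellK x); lra.
Qed.

Lemma is_derive_theta (x : R) : 0 < x < 1 ->
  is_derive theta x (1 / 2 - theta x ^ 2 / (2 * x * (1 - x))).
Proof.
intros Hx; assert (HK := ellK_pos x Hx).
assert (HdK := is_derive_ellK x Hx); assert (HdE := is_derive_ellE x Hx).
unfold theta; auto_derive.
- repeat split; [now eexists; apply HdE | now eexists; apply HdK | lra].
- replace (Derive (fun x0 : R => ellE x0) x) with ((ellE x - ellK x) / (2 * x))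
    by (symmetry; now apply is_derive_unique).
  replace (Derive (fun x0 : R => ellK x0) x) with ((ellE x - (1 - x) * ellK x) / (2 * x * (1 - x)))
    by (symmetry; now apply is_derive_unique).
  field; lra.
Qed.

(* The slope [1 / 200] lies between [1 / 320], needed near [x = 1], and [1 / 160], the slope of
   [theta / beta] at [0]. *)
Lemma theta_lower (x : R) : 0 < x < 1 -> (3 / 4 + x / 200) * beta x <= theta x.
Proof.
intros Hx.
enough (0 <= theta x - (3 / 4 + x / 200) * beta x) by lra.
pose (k := fun x => 3 / 4 + x / 200).
pose (s := fun x => k x * beta x).
pose (s' := fun x => beta x / 200 + k x * (1 - (beta x + (1 - x)) * beta x / (2 * x * (1 - x)))).
apply (nonneg_of_derive_where_neg (fun x => theta x - s x)
  (fun x => (1 / 2 - theta x ^ 2 / (2 * x * (1 - x))) - s' x)); [| | | exact Hx]; clear x Hx.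
- intros x Hx; apply (is_derive_minus (V := R_NormedModule)); [now apply is_derive_theta |].
  assert (Hd := is_derive_beta x Hx); unfold s, s', k; auto_derive.
  + now eexists; apply Hd.
  + replace (Derive (fun x0 : R => beta x0) x) with (1 - (beta x + (1 - x)) * beta x / (2 * x * (1 - x)))
      by (symmetry; now apply is_derive_unique).
    field; lra.
- intros x Hx Hneg; assert (Hb := beta_pos x Hx).
  assert (HP := lower_barrier_poly x (beta x) Hx Hb (beta_lower x Hx) (beta_cosh x Hx)); cbv zeta in HP.
  assert (Ht := theta_bounds x Hx).
  (* The right side of the equation of th decreases in th >= 0, so where th < s its derivative is at
     least the value of that right side at s, which exceeds s'. *)
  assert (Hs : theta x ^ 2 <= s x ^ 2) by (apply pow_incr; lra).
  apply Rmult_le_reg_r with (2 * x * (1 - x)); [nra |].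
  replace ((1 / 2 - theta x ^ 2 / (2 * x * (1 - x)) - s' x) * (2 * x * (1 - x))) with
    (x * (1 - x) - theta x ^ 2 - beta x / 100 * x * (1 - x) - k x * (2 * x * (1 - x) - (beta x + (1 - x)) * beta x))
    by (unfold s'; field; lra).
  unfold s, k in *; nra.
- intros eps Heps; exists (Rmin 1 eps); split; [apply Rmin_glb_lt; lra |].
  intros x Hx; generalize (Rmin_l 1 eps) (Rmin_r 1 eps); intros.
  assert (Hx1 : 0 < x < 1) by lra.
  assert (Hb := beta_pos x Hx1); assert (HU := beta_upper x Hx1); assert (Ht := theta_bounds x Hx1).
  unfold pade_upper in HU; assert (beta x <= x) by nra; unfold s, k; nra.
Qed.

(* [1 / 20] is the limit at [0] of [1 / theta - 1 / beta - 1 / (2 x)]. *)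
Lemma theta_upper (x : R) : 0 < x < 1 ->
  theta x * (20 * x + 10 * beta x + x * beta x) <= 20 * x * beta x.
Proof.
intros Hx.
pose (s := fun x => 20 * x * beta x / (20 * x + 10 * beta x + x * beta x)).
pose (s' := fun x => (s x) ^ 2 * ((1 - (beta x + (1 - x)) * beta x / (2 * x * (1 - x))) / beta x ^ 2
   + / (2 * x ^ 2))).
assert (Hpos : forall x, 0 < x < 1 -> 0 < 20 * x + 10 * beta x + x * beta x).
{ intros z Hz; assert (Hb := beta_pos z Hz); nra. }
enough (H : 0 <= s x - theta x).
{ assert (Hp := Hpos x Hx).
  apply Rmult_le_compat_r with (r := 20 * x + 10 * beta x + x * beta x) in H; [| lra].
  unfold s in H; rewrite Rmult_minus_distr_r in H.
  replace (_ / _ * _) with (20 * x * beta x) in H by (field; lra); lra. }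
apply (nonneg_of_derive_where_neg (fun x => s x - theta x)
  (fun x => s' x - (1 / 2 - theta x ^ 2 / (2 * x * (1 - x))))); [| | | exact Hx]; clear x Hx.
- intros x Hx; apply (is_derive_minus (V := R_NormedModule)); [| now apply is_derive_theta].
  assert (Hb := beta_pos x Hx); assert (Hp := Hpos x Hx).
  assert (Hd := is_derive_beta x Hx); unfold s', s; auto_derive.
  + repeat split; [now eexists; apply Hd .. |]; lra.
  + replace (Derive (fun x0 : R => beta x0) x) with (1 - (beta x + (1 - x)) * beta x / (2 * x * (1 - x)))
      by (symmetry; now apply is_derive_unique).
    field; repeat split; nra.
- intros x Hx Hneg; assert (Hb := beta_pos x Hx); assert (Hp := Hpos x Hx).
  assert (HP := upper_barrier_poly x (beta x) Hx Hb (beta_upper x Hx)).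
  assert (Hs0 : 0 < s x) by (unfold s; apply Rdiv_lt_0_compat; nra).
  assert (Hs : s x ^ 2 <= theta x ^ 2) by (apply pow_incr; lra).
  assert (H1 : s x ^ 2 / (2 * x * (1 - x)) <= theta x ^ 2 / (2 * x * (1 - x))).
  { apply Rmult_le_compat_r; [left; apply Rinv_0_lt_compat; nra | exact Hs]. }
  enough (0 <= s' x - 1 / 2 + s x ^ 2 / (2 * x * (1 - x))) by lra.
  replace (_ + _) with ((x ^ 2 - x * beta x / 2 + beta x ^ 2 / 2 - (x + beta x / 2 + x * beta x / 20) ^ 2 / 2)
    * (20 / (20 * x + 10 * beta x + x * beta x)) ^ 2).
  + apply Rmult_le_pos; [lra | apply pow2_ge_0].
  + unfold s', s; field; repeat split; nra.
- intros eps Heps; exists (Rmin 1 eps); split; [apply Rmin_glb_lt; lra |].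
  intros x Hx; generalize (Rmin_l 1 eps) (Rmin_r 1 eps); intros.
  assert (Hx1 : 0 < x < 1) by lra.
  assert (Hb := beta_pos x Hx1); assert (Hp := Hpos x Hx1); assert (Ht := theta_bounds x Hx1).
  assert (0 < s x) by (unfold s; apply Rdiv_lt_0_compat; nra); lra.
Qed.

(** * Sign of the derivatives *)

Definition gsq (c x : R) : R := (3 / 4 + c * x) * ln (arthq x) - ln (2 * ellK x / PI).
Definition gsq' (c x : R) : R :=
  ((3 / 4 + c * x) * beta x - theta x) / (2 * x * (1 - x)) + c * ln (arthq x).

Lemma pow2_unit (r : R) : 0 < r < 1 -> 0 < r ^ 2 < 1.
Proof. nra. Qed.

Lemma g_gsq (c r : R) : 0 < r < 1 -> g c r = gsq c (r ^ 2).
Proof.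
intros Hr; unfold g, gsq, arthq; rewrite sqrt_pow2 by lra; reflexivity.
Qed.

Lemma is_derive_gsq (c x : R) : 0 < x < 1 -> is_derive (gsq c) x (gsq' c x).
Proof.
intros Hx; assert (HA := arthq_gt_1 x Hx); assert (HK := ellK_pos x Hx).
assert (HdA := is_derive_arthq x Hx); assert (HdK := is_derive_ellK x Hx).
unfold gsq; auto_derive.
- repeat split; [now eexists; apply HdA | lra | now eexists; apply HdK |].
  apply Rmult_lt_0_compat; [lra | apply Rinv_0_lt_compat, PI_RGT_0].
- replace (Derive (fun x0 : R => arthq x0) x) with ((/ (1 - x) - arthq x) / (2 * x))
    by (symmetry; now apply is_derive_unique).
  replace (Derive (fun x0 : R => ellK x0) x) with ((ellE x - (1 - x) * ellK x) / (2 * x * (1 - x)))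
    by (symmetry; now apply is_derive_unique).
  generalize PI_RGT_0; intros; unfold gsq', beta, theta; field; lra.
Qed.

Lemma is_derive_gsq' (c x : R) : 0 < x < 1 ->
  is_derive (gsq' c) x (curv c x (beta x) (theta x) / (4 * x ^ 2 * (1 - x) ^ 2)).
Proof.
intros Hx; assert (HA := arthq_gt_1 x Hx).
assert (HdA := is_derive_arthq x Hx); assert (Hdb := is_derive_beta x Hx).
assert (Hdt := is_derive_theta x Hx).
unfold gsq'; auto_derive.
- repeat split; [now eexists; apply Hdb | now eexists; apply Hdt | nra | now eexists; apply HdA | lra].
- replace (Derive (fun x0 : R => arthq x0) x) with ((/ (1 - x) - arthq x) / (2 * x))
    by (symmetry; now apply is_derive_unique).
  replace (Derive (fun x0 : R => beta x0) x) with (1 - (beta x + (1 - x)) * beta x / (2 * x * (1 - x)))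
    by (symmetry; now apply is_derive_unique).
  replace (Derive (fun x0 : R => theta x0) x) with (1 / 2 - theta x ^ 2 / (2 * x * (1 - x)))
    by (symmetry; now apply is_derive_unique).
  replace (1 * ((/ (1 - x) - arthq x) / (2 * x)) * / arthq x) with (beta x / (2 * x * (1 - x)))
    by (unfold beta; field; lra).
  unfold curv; field; lra.
Qed.

Lemma curv_c_monotone (x b t c d : R) : 0 < x < 1 -> 0 < b < x -> c <= d ->
  curv c x b t <= curv d x b t.
Proof.
intros Hx Hb Hcd.
assert (0 <= (d - c) * (x * (2 * x * (1 - x) + b * (1 + x - b)))).
{ apply Rmult_le_pos; [lra |]; apply Rmult_le_pos; [lra |].
  apply Rplus_le_le_0_compat; repeat apply Rmult_le_pos; lra. }
unfold curv; lra.
Qed.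

Lemma beta_le (x : R) : 0 < x < 1 -> beta x <= 2 / 3 * x.
Proof. intros Hx; assert (H := beta_upper x Hx); unfold pade_upper in H; nra. Qed.

Lemma theta_beta (x : R) : 0 < x < 1 -> 3 / 4 * beta x <= theta x /\ theta x * (2 * x + beta x) <= 2 * x * beta x.
Proof.
intros Hx; assert (Hb := beta_pos x Hx); assert (H1 := theta_lower x Hx); assert (H2 := theta_upper x Hx).
assert (Ht := theta_bounds x Hx); split; nra.
Qed.

Lemma curv_pos_c (c x : R) : 0 < x < 1 -> 1 / 4 <= c -> 0 < curv c x (beta x) (theta x).
Proof.
intros Hx Hc; assert (Hb := beta_pos x Hx); assert (Hb2 := beta_le x Hx).
destruct (theta_beta x Hx) as [H1 H2].
apply Rlt_le_trans with (curv (1 / 4) x (beta x) (theta x)).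
- apply curv_pos; trivial; now apply beta_upper.
- apply curv_c_monotone; lra.
Qed.

Lemma curv_neg_c (c x : R) : 0 < x < 1 -> c <= 1 / 320 -> curv c x (beta x) (theta x) < 0.
Proof.
intros Hx Hc; assert (Hb := beta_pos x Hx); assert (Hb2 := beta_le x Hx).
apply Rle_lt_trans with (curv (1 / 320) x (beta x) (theta x)).
- apply curv_c_monotone; lra.
- apply curv_neg; auto using beta_lower, beta_upper, beta_cosh, theta_bounds, theta_lower, theta_upper.
Qed.

(** * Monotonicity and convexity from derivatives *)

Lemma lt_of_derive_pos (f df : R -> R) (a b : R) :
  (forall x, a < x < b -> is_derive f x (df x)) ->
  (forall x, a < x < b -> 0 < df x) ->
  strictly_increasing_on a b f.
Proof.
intros Hd Hp x y Hx Hy Hxy.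
destruct (mvt_is_derive f df x y Hxy) as [z [Hz He]]; [intros; apply Hd; lra |].
assert (0 < df z * (y - x)) by (apply Rmult_lt_0_compat; [apply Hp |]; lra); lra.
Qed.

Lemma gt_of_derive_neg (f df : R -> R) (a b : R) :
  (forall x, a < x < b -> is_derive f x (df x)) ->
  (forall x, a < x < b -> df x < 0) ->
  strictly_decreasing_on a b f.
Proof.
intros Hd Hp x y Hx Hy Hxy.
destruct (mvt_is_derive f df x y Hxy) as [z [Hz He]]; [intros; apply Hd; lra |].
specialize (Hp z ltac:(lra)); nra.
Qed.

Lemma convex_of_derive (f df : R -> R) (a b : R) :
  (forall x, a < x < b -> is_derive f x (df x)) ->
  (forall x y, a < x < b -> a < y < b -> x < y -> df x <= df y) ->
  convex_on a b f.
Proof.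
intros Hd Hm.
assert (Hlt : forall x y t, a < x < b -> a < y < b -> x < y -> 0 < t < 1 ->
  f (t * x + (1 - t) * y) <= t * f x + (1 - t) * f y).
{ intros x y t Hx Hy Hxy Ht; set (z := t * x + (1 - t) * y).
  assert (Hz1 : z - x = (1 - t) * (y - x)) by (unfold z; ring).
  assert (Hz2 : y - z = t * (y - x)) by (unfold z; ring).
  assert (Hz : x < z < y) by (split; nra).
  destruct (mvt_is_derive f df x z) as [u [Hu Hu']]; [lra | intros; apply Hd; lra |].
  destruct (mvt_is_derive f df z y) as [v [Hv Hv']]; [lra | intros; apply Hd; lra |].
  assert (Hm' := Hm u v ltac:(lra) ltac:(lra) ltac:(lra)).
  rewrite Hz1 in Hu'; rewrite Hz2 in Hv'.
  assert (0 <= t * (1 - t) * (y - x) * (df v - df u))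
    by (repeat apply Rmult_le_pos; lra).
  assert (f x = f z - df u * ((1 - t) * (y - x))) by lra.
  assert (f y = f z + df v * (t * (y - x))) by lra.
  nra. }
intros x y t Hx Hy Ht.
destruct (Req_dec t 0) as [-> | Ht0].
{ replace (0 * x + (1 - 0) * y) with y by ring; lra. }
destruct (Req_dec t 1) as [-> | Ht1].
{ replace (1 * x + (1 - 1) * y) with x by ring; lra. }
destruct (Rtotal_order x y) as [Hxy | [-> | Hxy]].
- apply Hlt; lra.
- replace (t * y + (1 - t) * y) with y by ring; lra.
- assert (H := Hlt y x (1 - t) Hy Hx Hxy ltac:(lra)).
  replace ((1 - t) * y + (1 - (1 - t)) * x) with (t * x + (1 - t) * y) in H by ring; lra.
Qed.

Lemma concave_of_derive (f df : R -> R) (a b : R) :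
  (forall x, a < x < b -> is_derive f x (df x)) ->
  (forall x y, a < x < b -> a < y < b -> x < y -> df y <= df x) ->
  concave_on a b f.
Proof.
intros Hd Hm.
assert (H : convex_on a b (fun x => - f x)).
{ apply convex_of_derive with (fun x => - df x).
  - intros x Hx; apply (is_derive_opp f); now apply Hd.
  - intros x y Hx Hy Hxy; generalize (Hm x y Hx Hy Hxy); lra. }
intros x y t Hx Hy Ht; generalize (H x y t Hx Hy Ht); lra.
Qed.

Lemma gsq'_increasing (c : R) : 1 / 4 <= c -> strictly_increasing_on 0 1 (gsq' c).
Proof.
intros Hc; apply lt_of_derive_pos with (1 := is_derive_gsq' c).
intros x Hx; apply Rdiv_lt_0_compat; [now apply curv_pos_c |].
repeat apply Rmult_lt_0_compat; try apply pow_lt; lra.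
Qed.

Lemma gsq'_decreasing (c : R) : c <= 1 / 320 -> strictly_decreasing_on 0 1 (gsq' c).
Proof.
intros Hc; apply gt_of_derive_neg with (1 := is_derive_gsq' c).
intros x Hx; assert (H := curv_neg_c c x Hx Hc).
apply Ropp_lt_cancel; rewrite Ropp_0; unfold Rdiv; rewrite Ropp_mult_distr_l.
apply Rdiv_lt_0_compat; [lra | repeat apply Rmult_lt_0_compat; try apply pow_lt; lra].
Qed.

Lemma ln_arthq_pos (x : R) : 0 < x < 1 -> 0 < ln (arthq x).
Proof.
intros Hx; assert (HA := arthq_gt_1 x Hx); rewrite <- ln_1; apply ln_increasing; lra.
Qed.

Lemma ln_le_sub (x : R) : 0 < x -> ln x <= x - 1.
Proof.
intros Hx; generalize (exp_ineq1_le (ln x)); rewrite exp_ln by trivial; lra.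
Qed.

Lemma arthq_beta (x : R) : 0 < x < 1 -> arthq x = / (beta x + (1 - x)).
Proof. intros Hx; unfold beta; replace (_ + _) with (/ arthq x) by ring; now rewrite Rinv_inv. Qed.

Lemma ln_arthq_upper (x : R) : 0 < x < 1 -> ln (arthq x) <= x / (1 - x).
Proof.
intros Hx; assert (HA := arthq_gt_1 x Hx); assert (Hb := beta_pos x Hx).
apply (Rle_trans _ (arthq x - 1)); [apply ln_le_sub; lra |].
replace (x / (1 - x)) with (/ (1 - x) - 1) by (field; lra).
rewrite arthq_beta by trivial; apply Rplus_le_compat_r, Rinv_le_contravar; lra.
Qed.

Lemma ln_arthq_lower (x : R) : 0 < x < 1 -> x - beta x <= ln (arthq x).
Proof.
intros Hx; assert (HA := arthq_gt_1 x Hx).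
generalize (ln_le_sub (/ arthq x) ltac:(apply Rinv_0_lt_compat; lra)).
rewrite ln_Rinv by lra; unfold beta; lra.
Qed.

(** It suffices that th <= (3 / 4 + x / 4) b. By th <= 2 x b / (2 x + b) this reduces to 2 x (1 - x)
    <= b (3 + x), which the Padé lower bound of b gives. *)
Lemma gsq'_pos (c x : R) : 1 / 4 <= c -> 0 < x < 1 -> 0 < gsq' c x.
Proof.
intros Hc Hx; assert (Hb := beta_pos x Hx); assert (HL := beta_lower x Hx).
destruct (theta_beta x Hx) as [_ Ht]; assert (Hln := ln_arthq_pos x Hx).
unfold gsq'; apply Rplus_le_lt_0_compat; [| apply Rmult_lt_0_compat; lra].
apply Rcomplements.Rdiv_le_0_compat; [| nra].
assert (Hb2 : 2 * x * (1 - x) <= beta x * (3 + x)).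
{ assert (HD := lower_poly_pos x Hx); unfold pade_lower in HL.
  apply Rmult_le_reg_r with (315 - 420 * x + 113 * x ^ 2); [trivial |].
  apply Rle_trans with (14 * x * (1 - x) * (15 - 7 * x) * (3 + x)); [| nra].
  assert (0 <= 2 * x * (1 - x)) by nra; nra. }
assert (Hcx : 0 <= (c - 1 / 4) * (x * beta x)) by (repeat apply Rmult_le_pos; lra).
enough (theta x <= (3 / 4 + x / 4) * beta x) by lra.
apply Rmult_le_reg_r with (2 * x + beta x); [lra |].
apply (Rle_trans _ _ _ Ht).
enough (8 * x <= (3 + x) * (2 * x + beta x)) by nra.
nra.
Qed.

(** G' is decreasing, so a nonnegative value at x would keep G' above some delta > 0 near 0. But 3 /
    4 b <= th leaves only terms with the factor c, whence G'(z) <= z for small z. *)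
Lemma gsq'_neg (c x : R) : 0 < c <= 1 / 320 -> 0 < x < 1 -> gsq' c x < 0.
Proof.
intros Hc Hx; apply Rnot_le_lt; intros Hge.
assert (Hdec := gsq'_decreasing c (proj2 Hc)).
assert (H1 := Hdec (x / 2) x ltac:(lra) Hx ltac:(lra)).
set (delta := gsq' c (x / 2)) in *.
set (z := Rmin (x / 4) (delta / 2)).
assert (Hz : 0 < z <= x / 4 /\ z <= delta / 2).
{ unfold z; generalize (Rmin_l (x / 4) (delta / 2)) (Rmin_r (x / 4) (delta / 2)).
  assert (0 < Rmin (x / 4) (delta / 2)) by (apply Rmin_glb_lt; lra); lra. }
assert (H2 := Hdec z (x / 2) ltac:(lra) ltac:(lra) ltac:(lra)); fold delta in H2.
assert (Hz1 : 0 < z < 1) by lra.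
enough (gsq' c z <= z) by lra.
assert (Hln := ln_arthq_upper z Hz1); assert (Hb := beta_pos z Hz1).
assert (Hb2 := beta_le z Hz1); destruct (theta_beta z Hz1) as [Ht _].
assert (Hinv : / (1 - z) <= 2).
{ replace 2 with (/ / 2) by field; apply Rinv_le_contravar; lra. }
unfold gsq'.
apply Rle_trans with (c * (beta z / 2) * / (1 - z) + c * (z * / (1 - z))).
- apply Rplus_le_compat.
  + replace (c * (beta z / 2) * / (1 - z)) with (c * z * beta z / (2 * z * (1 - z))) by (field; lra).
    apply Rmult_le_compat_r; [left; apply Rinv_0_lt_compat; nra | lra].
  + apply Rmult_le_compat_l; lra.
- assert (0 < / (1 - z)) by (apply Rinv_0_lt_compat; lra).
  set (v := / (1 - z)) in *.
  assert (beta z / 2 * v <= 2 / 3 * z) by nra.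
  assert (z * v <= 2 * z) by nra.
  assert (c * (beta z / 2 * v) <= 1 * (2 / 3 * z / 4)) by nra.
  nra.
Qed.

(** * Limits *)

(** The right side is 2 x (1 - x) G' at c = 1 / 320, with ln A replaced by its lower bound x - b.
    Its terms of order x and x^2 cancel. *)
Lemma upper_barrier_expansion (x b t : R) :
  0 < x <= 1 / 2 -> 0 < b -> pade_lower x b -> pade_upper x b ->
  t * (20 * x + 10 * b + x * b) <= 20 * x * b ->
  - x ^ 3 <= (3 / 4 + x / 320) * b - t + x * (1 - x) / 160 * (x - b).
Proof.
unfold pade_lower, pade_upper; intros Hx Hb HL HU Ht.
(* 2 / 3 - 4 / 45 x is the expansion of b / x at 0; the Padé bounds confine the coefficient e of the
   remainder to [0, 1 / 5]. *)
set (e := (2 / 3 - 4 / 45 * x - b / x) / x ^ 2).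
assert (Hbe : b = x * (2 / 3 - 4 / 45 * x - x ^ 2 * e)) by (unfold e; field; lra).
clearbody e.
assert (Hx3 : 0 < x ^ 3) by (apply pow_lt; lra).
assert (He0 : 0 <= e).
{ apply Rmult_le_reg_l with (x ^ 3 * (105 - 55 * x)); [nra |].
  rewrite Hbe in HU; nra. }
assert (He1 : e <= 1 / 5).
{ apply Rmult_le_reg_l with (x ^ 3 * (315 - 420 * x + 113 * x ^ 2)); [nra |].
  rewrite Hbe in HL; nra. }
set (w := 2 / 3 - 4 / 45 * x - x ^ 2 * e) in *.
assert (Hw : 1 / 2 <= w <= 2 / 3) by (unfold w; nra).
assert (Hf : - 20 * x ^ 2 <= w * (- 5 + 15 / 2 * w + 25 / 32 * x * w + x / 16 + x ^ 2 * w / 320)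
  + x * (1 - x) / 160 * (1 - w) * (20 + 10 * w + x * w)).
{ set (al := 15 / 2 * e + 25 / 32 * (4 / 45 + x * e) - w / 320).
  assert (Hal : al <= 3).
  { assert (x * e <= 1 / 2 * (1 / 5)) by (apply Rmult_le_compat; lra); unfold al; lra. }
  replace (- 5 + 15 / 2 * w + 25 / 32 * x * w + x / 16 + x ^ 2 * w / 320) with
    (- x / 12 - x ^ 2 * al) by (unfold al, w; field).
  assert (Hx2 : 0 <= x ^ 2) by (apply pow_le; lra).
  assert (H1 : w * (x ^ 2 * al) <= 2 / 3 * (x ^ 2 * 3)).
  { apply Rle_trans with (w * (x ^ 2 * 3)); [| apply Rmult_le_compat_r; lra].
    apply Rmult_le_compat_l; [lra |]; apply Rmult_le_compat_l; lra. }
  assert (H2 : 80 / 9 <= (1 - w) * (20 + 10 * w + x * w)).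
  { assert (0 <= (1 - w) * (x * w)) by (repeat apply Rmult_le_pos; lra); nra. }
  assert (H3 : x * (1 - x) / 160 * (80 / 9) <= x * (1 - x) / 160 * ((1 - w) * (20 + 10 * w + x * w))).
  { apply Rmult_le_compat_l; [| exact H2].
    apply Rcomplements.Rdiv_le_0_compat; [apply Rmult_le_pos |]; lra. }
  assert (H4 : x * w <= x * (2 / 3)) by (apply Rmult_le_compat_l; lra).
  lra. }
set (Q := (3 / 4 + x / 320) * b + x * (1 - x) / 160 * (x - b)).
assert (HQ : - 20 * x ^ 4 <= (Q - t) * (20 * x + 10 * b + x * b)).
{ assert (H : Q * (20 * x + 10 * b + x * b) - 20 * x * b = x ^ 2 *
   (w * (- 5 + 15 / 2 * w + 25 / 32 * x * w + x / 16 + x ^ 2 * w / 320)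
  + x * (1 - x) / 160 * (1 - w) * (20 + 10 * w + x * w))) by (unfold Q; rewrite Hbe; field).
  assert (0 < x ^ 2) by (apply pow_lt; lra). nra. }
apply Rnot_lt_le; intros Hlt.
assert (Q - t < - x ^ 3) by (unfold Q; lra).
assert ((Q - t) * (20 * x) < - x ^ 3 * (20 * x)) by (apply Rmult_lt_compat_r; lra).
assert (0 < x * b) by (apply Rmult_lt_0_compat; lra).
assert ((Q - t) * (20 * x + 10 * b + x * b) <= (Q - t) * (20 * x))
  by (apply Rmult_le_compat_neg_l; lra).
lra.
Qed.

(** The excess eps = c - 1 / 320 adds at least eps x^2 / 3 to 2 x (1 - x) G', which beats the error
    x^3 as soon as x < eps / 3. *)
Lemma gsq'_pos_near_0 (c : R) : 1 / 320 < c ->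
  exists delta, 0 < delta <= 1 / 2 /\ forall x, 0 < x < delta -> 0 < gsq' c x.
Proof.
intros Hc; exists (Rmin (1 / 2) ((c - 1 / 320) / 3)).
split; [split; [apply Rmin_glb_lt; lra | apply Rmin_l] |].
intros x Hx; generalize (Rmin_l (1 / 2) ((c - 1 / 320) / 3)) (Rmin_r (1 / 2) ((c - 1 / 320) / 3)).
intros Hm1 Hm2; assert (Hx1 : 0 < x < 1) by lra.
assert (Hb := beta_pos x Hx1); assert (Hb2 := beta_le x Hx1).
assert (He := upper_barrier_expansion x (beta x) (theta x) ltac:(lra) Hb (beta_lower x Hx1)
  (beta_upper x Hx1) (theta_upper x Hx1)).
assert (Hln := ln_arthq_lower x Hx1).
assert (Hxy : 0 < 2 * x * (1 - x)) by nra.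
apply Rmult_lt_reg_r with (2 * x * (1 - x)); [exact Hxy |]; rewrite Rmult_0_l.
replace (gsq' c x * (2 * x * (1 - x))) with
  ((3 / 4 + c * x) * beta x - theta x + 2 * x * (1 - x) * c * ln (arthq x)) by (unfold gsq'; field; lra).
apply Rlt_le_trans with
  ((3 / 4 + c * x) * beta x - theta x + 2 * x * (1 - x) * c * (x - beta x)).
2: { apply Rplus_le_compat_l, Rmult_le_compat_l; [apply Rmult_le_pos; lra | trivial]. }
set (eps := c - 1 / 320) in *.
replace c with (1 / 320 + eps) by (unfold eps; ring).
assert (0 < eps) by (unfold eps; lra).
assert (Hx2 : 0 < x ^ 2) by (apply pow_lt; lra).
assert (H1 : x ^ 2 * (3 * x) < x ^ 2 * eps) by (apply Rmult_lt_compat_l; lra).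
assert (H2 : x ^ 2 / 3 <= 2 * x * (1 - x) * (x - beta x)).
{ apply Rle_trans with (2 * x * (1 / 2) * (1 / 3 * x)); [right; field |].
  apply Rmult_le_compat; [lra | lra | nra | lra]. }
assert (H3 : eps * (x ^ 2 / 3) <= eps * (2 * x * (1 - x) * (x - beta x)))
  by (apply Rmult_le_compat_l; lra).
assert (0 < eps * (x * beta x)) by (repeat apply Rmult_lt_0_compat; lra).
lra.
Qed.

Lemma at_left_1_intro (P : R -> Prop) (d : R) :
  d < 1 -> (forall r, 0 < r < 1 -> d < r -> P r) -> at_left 1 P.
Proof.
intros Hd HP.
assert (Hm : 0 < Rmin (1 - d) 1) by (apply Rmin_glb_lt; lra).
exists (mkposreal _ Hm); intros r Hr Hr1.
generalize (Rmin_l (1 - d) 1) (Rmin_r (1 - d) 1); intros.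
apply Rabs_def2 in Hr; unfold minus, plus, opp in Hr; simpl in Hr; apply HP; lra.
Qed.

Lemma arthq_at_left_1 (M : R) : at_left 1 (fun r => 1 / 2 <= r ^ 2 < 1 /\ M < arthq (r ^ 2)).
Proof.
(* If 1 - r < exp (- 2 M), then (1 + r) / (1 - r) > exp (2 M), that is arth r > M; and r > 3 / 4
   ensures r^2 >= 1 / 2. *)
apply at_left_1_intro with (Rmax (3 / 4) (1 - exp (- 2 * M))).
- apply Rmax_lub_lt; [lra | generalize (exp_pos (- 2 * M)); lra].
- intros r Hr Hm; generalize (Rmax_l (3 / 4) (1 - exp (- 2 * M))) (Rmax_r (3 / 4) (1 - exp (- 2 * M))).
  intros; split; [nra |].
  unfold arthq; rewrite sqrt_pow2 by lra.
  assert (Ha : M < arth r).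
  { unfold arth; enough (2 * M < ln ((1 + r) / (1 - r))) by lra.
    rewrite <- (ln_exp (2 * M)); apply ln_increasing; [apply exp_pos |].
    apply Rmult_lt_reg_r with (1 - r); [lra |].
    replace (_ / _ * _) with (1 + r) by (field; lra).
    assert (H2 : 1 - r < exp (- 2 * M)) by lra.
    apply Rmult_lt_compat_l with (r := exp (2 * M)) in H2; [| apply exp_pos].
    rewrite <- exp_plus in H2; replace (2 * M + - 2 * M) with 0 in H2 by ring.
    rewrite exp_0 in H2; lra. }
  assert (Ha0 : 0 < arth r).
  { assert (HA := arthq_gt_1 (r ^ 2) (pow2_unit r Hr)).
    unfold arthq in HA; rewrite sqrt_pow2 in HA by lra.
    replace (arth r) with (arth r / r * r) by (field; lra); nra. }
  apply Rlt_le_trans with (1 := Ha).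
  apply Rmult_le_reg_r with r; [lra |].
  replace (arth r / r * r) with (arth r) by (field; lra); nra.
Qed.

Lemma arthq_ellK (x : R) : 0 < x < 1 -> arthq x <= ellK x <= arthq x + PI / 2.
Proof.
intros Hx; assert (Hs := sqrt_unit x Hx).
generalize (arth_le_ellK _ Hs) (ellK_le_arth _ Hs); rewrite pow2_sqrt by lra.
unfold arthq; lra.
Qed.

(** From A <= K <= A + PI / 2 follows 0 <= ln (K / A) <= K / A - 1 <= PI / 2 / A, an error that
    vanishes as A tends to infinity. *)
Lemma ln_ellK_bounds (x : R) : 0 < x < 1 ->
  ln (arthq x) - ln (PI / 2) <= ln (2 * ellK x / PI)
    <= ln (arthq x) - ln (PI / 2) + PI / 2 / arthq x.
Proof.
intros Hx; assert (HA := arthq_gt_1 x Hx); assert (HK := arthq_ellK x Hx).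
assert (HP := PI_RGT_0).
replace (2 * ellK x / PI) with (ellK x / arthq x * arthq x * / (PI / 2)) by (field; lra).
assert (HKA : 1 <= ellK x / arthq x).
{ apply Rmult_le_reg_r with (arthq x); [lra |].
  replace (_ / _ * _) with (ellK x) by (field; lra); lra. }
assert (H0 : 0 < / (PI / 2)) by (apply Rinv_0_lt_compat; lra).
assert (H1 : 0 < ellK x / arthq x * arthq x) by (apply Rmult_lt_0_compat; lra).
rewrite (ln_mult _ _ H1 H0), (ln_mult (_ / _) (arthq x)), ln_Rinv by lra.
assert (0 <= ln (ellK x / arthq x)).
{ rewrite <- ln_1; apply ln_le; lra. }
assert (ln (ellK x / arthq x) <= PI / 2 / arthq x).
{ apply (Rle_trans _ (ellK x / arthq x - 1)); [apply ln_le_sub; lra |].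
  replace (ellK x / arthq x - 1) with ((ellK x - arthq x) / arthq x) by (field; lra).
  apply Rmult_le_compat_r; [left; apply Rinv_0_lt_compat; lra | lra]. }
lra.
Qed.

Lemma PI2_lt_2 : PI / 2 <= 2.
Proof. generalize PI_4; lra. Qed.

Lemma PI2_div_arthq (x : R) : 0 < x < 1 -> 0 < PI / 2 / arthq x <= 2 / arthq x.
Proof.
intros Hx; assert (HA := arthq_gt_1 x Hx); assert (0 < / arthq x) by (apply Rinv_0_lt_compat; lra).
generalize PI2_lt_2 PI2_pos; intros; split; [now apply Rdiv_lt_0_compat; lra |].
apply Rmult_le_compat_r; lra.
Qed.

Lemma is_lim_left_g_quarter : is_lim_left (g (1 / 4)) 1 (ln (PI / 2)).
Proof.
apply filterlim_locally; intros eps.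
generalize (at_left_1_intro (fun r => 0 < r < 1) 0 ltac:(lra) ltac:(auto)) (arthq_at_left_1 (3 / eps)).
intros H1 H2; generalize (filter_and _ _ H1 H2); apply filter_imp.
intros r [Hr [Hr2 HA]]; rewrite g_gsq by trivial.
assert (Hx := pow2_unit r Hr); set (x := r ^ 2) in *.
assert (HA1 := arthq_gt_1 x Hx); assert (HK := ln_ellK_bounds x Hx).
assert (HP := PI2_div_arthq x Hx); assert (Hc := arthq_cosh x Hx).
assert (Hln := ln_arthq_pos x Hx); assert (Hln2 := ln_le_sub (arthq x) ltac:(lra)).
assert (He := cond_pos eps).
set (A := arthq x) in *.
(* The remaining term (1 - x) ln A / 4 tends to 0: the cosh bound gives (1 - x) A^2 <= 2 for x >= 1
   / 2, and ln A <= A. Together with PI / 2 / A the total error is below 3 / A. *)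
assert (Hy : (1 - x) * ln A <= 2 / A).
{ apply Rmult_le_reg_r with A; [lra |]; replace (2 / A * A) with 2 by (field; lra).
  assert (0 <= A ^ 4) by (apply pow_le; lra).
  assert (0 <= (1 - x) * (x ^ 2 * A ^ 4 / 3)).
  { apply Rmult_le_pos; [lra |]; apply Rcomplements.Rdiv_le_0_compat; [| lra].
    apply Rmult_le_pos; [apply pow_le |]; lra. }
  assert ((1 - x) * (x * A ^ 2) <= 1) by lra.
  assert ((1 - x) * A ^ 2 <= 2).
  { assert (0 <= (1 - x) * (A ^ 2 * (x - 1 / 2))); [| lra].
    apply Rmult_le_pos; [lra |]; apply Rmult_le_pos; [apply pow2_ge_0 | lra]. }
  assert (0 <= (1 - x) * (A * (A - ln A))) by (apply Rmult_le_pos; [| apply Rmult_le_pos]; lra).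
  lra. }
assert (HA3 : 3 / A < eps).
{ apply Rmult_lt_reg_r with A; [lra |]; replace (3 / A * A) with 3 by (field; lra).
  apply Rmult_lt_compat_l with (r := eps) in HA; trivial.
  replace (eps * (3 / eps)) with 3 in HA by (field; lra); lra. }
assert (0 <= (1 - x) * ln A) by (apply Rmult_le_pos; lra).
assert (H3 : 3 / A = 3 / 2 * (2 / A)) by (field; lra).
apply Rabs_def1; unfold minus, plus, opp; simpl; unfold gsq; fold A; lra.
Qed.

Lemma is_lim_left_g_above (c : R) : 1 / 4 < c -> is_lim_left (g c) 1 p_infty.
Proof.
intros Hc P [M HM]; unfold filtermap.
(* Beyond d, c r^2 exceeds the midpoint of 1 / 4 and c, so the coefficient of ln A in the lower
   bound of g is at least (c - 1 / 4) / 2. *)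
set (d := sqrt ((1 / 4 + (c - 1 / 4) / 2) / c)).
assert (Hd0 : 0 < (1 / 4 + (c - 1 / 4) / 2) / c) by (apply Rdiv_lt_0_compat; lra).
assert (Hd : d < 1).
{ apply Rlt_le_trans with (sqrt 1); [| rewrite sqrt_1; lra].
  apply sqrt_lt_1_alt; split; [lra |].
  apply Rmult_lt_reg_r with c; [lra |]; replace (_ / c * c) with (1 / 4 + (c - 1 / 4) / 2)
    by (field; lra); lra. }
generalize (at_left_1_intro (fun r => 0 < r < 1 /\ d < r) d Hd
  (fun r H1 H2 => conj H1 H2))
  (arthq_at_left_1 (exp (2 * (Rabs M + 2 + Rabs (ln (PI / 2))) / (c - 1 / 4)))).
intros H1 H2; generalize (filter_and _ _ H1 H2); apply filter_imp.
intros r [[Hr Hdr] [Hr2 HA]]; apply HM; rewrite g_gsq by trivial.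
assert (Hcx : 1 / 4 + (c - 1 / 4) / 2 <= c * r ^ 2).
{ assert (Hd2 : d ^ 2 = (1 / 4 + (c - 1 / 4) / 2) / c) by (apply pow2_sqrt; lra).
  assert (Hdn : 0 <= d) by apply sqrt_pos.
  assert (d ^ 2 <= r ^ 2) by (apply pow_incr; lra).
  replace (1 / 4 + (c - 1 / 4) / 2) with (c * d ^ 2) by (rewrite Hd2; field; lra).
  apply Rmult_le_compat_l; lra. }
assert (Hx := pow2_unit r Hr); set (x := r ^ 2) in *.
assert (HA1 := arthq_gt_1 x Hx); assert (HK := ln_ellK_bounds x Hx).
assert (HP := PI2_div_arthq x Hx).
apply ln_increasing in HA; [| apply exp_pos]; rewrite ln_exp in HA.
assert (HAi : 2 / arthq x <= 2).
{ apply Rmult_le_reg_r with (arthq x); [lra |].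
  replace (2 / arthq x * arthq x) with 2 by (field; lra); lra. }
apply Rmult_lt_compat_r with (r := (c - 1 / 4) / 2) in HA; [| lra].
replace (2 * (Rabs M + 2 + Rabs (ln (PI / 2))) / (c - 1 / 4) * ((c - 1 / 4) / 2)) with
  (Rabs M + 2 + Rabs (ln (PI / 2))) in HA by (field; lra).
generalize (Rle_abs M) (Rle_abs (- ln (PI / 2))); rewrite Rabs_Ropp; intros.
assert (Hln := ln_arthq_pos x Hx).
assert (0 <= (c * x - 1 / 4 - (c - 1 / 4) / 2) * ln (arthq x)) by (apply Rmult_le_pos; lra).
unfold gsq; lra.
Qed.

Lemma is_lim_left_g_below (c : R) : 0 < c < 1 / 4 -> is_lim_left (g c) 1 m_infty.
Proof.
intros Hc P [M HM]; unfold filtermap.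
generalize (at_left_1_intro (fun r => 0 < r < 1) 0 ltac:(lra) ltac:(auto))
  (arthq_at_left_1 (exp ((Rabs M + Rabs (ln (PI / 2))) / (1 / 4 - c)))).
intros H1 H2; generalize (filter_and _ _ H1 H2); apply filter_imp.
intros r [Hr [Hr2 HA]]; apply HM; rewrite g_gsq by trivial.
assert (Hx := pow2_unit r Hr); set (x := r ^ 2) in *.
assert (HA1 := arthq_gt_1 x Hx); assert (HK := ln_ellK_bounds x Hx).
apply ln_increasing in HA; [| apply exp_pos]; rewrite ln_exp in HA.
apply Rmult_lt_compat_r with (r := 1 / 4 - c) in HA; [| lra].
replace ((Rabs M + Rabs (ln (PI / 2))) / (1 / 4 - c) * (1 / 4 - c)) with
  (Rabs M + Rabs (ln (PI / 2))) in HA by (field; lra).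
generalize (Rle_abs (- M)) (Rle_abs (ln (PI / 2))); rewrite Rabs_Ropp; intros.
assert (Hln := ln_arthq_pos x Hx).
assert (0 <= c * (1 - x) * ln (arthq x)) by (repeat apply Rmult_le_pos; lra).
unfold gsq; lra.
Qed.

(** The upper bound comes from (1 - x) K <= E <= PI / 2, that is 2 K / PI - 1 <= x / (1 - x). *)
Lemma ln_ellK_small (x : R) : 0 < x < 1 -> 0 <= ln (2 * ellK x / PI) <= x / (1 - x).
Proof.
intros Hx; assert (HP := PI_RGT_0); assert (HK := ellK_lower x ltac:(lra)).
assert (HE := ellE_ge_ellK x ltac:(lra)); assert (HE2 := ellE_upper x ltac:(lra)).
assert (H1 : 1 <= 2 * ellK x / PI).
{ apply Rmult_le_reg_r with PI; [lra |]; replace (_ / PI * PI) with (2 * ellK x) by (field; lra); lra. }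
split; [rewrite <- ln_1; apply ln_le; lra |].
apply (Rle_trans _ (2 * ellK x / PI - 1)); [apply ln_le_sub; lra |].
apply Rmult_le_reg_r with (PI * (1 - x)); [apply Rmult_lt_0_compat; lra |].
replace (x / (1 - x) * (PI * (1 - x))) with (PI * x) by (field; lra).
replace ((2 * ellK x / PI - 1) * (PI * (1 - x))) with (2 * ((1 - x) * ellK x) - PI * (1 - x))
  by (field; lra).
lra.
Qed.

Lemma is_lim_right_g (c : R) : 0 < c -> is_lim_right (g c) 0 0.
Proof.
intros Hc; apply filterlim_locally; intros eps.
assert (He := cond_pos eps).
assert (Hm : 0 < Rmin (1 / 2) (eps / (4 + 2 * c))).
{ apply Rmin_glb_lt; [lra | apply Rdiv_lt_0_compat; lra]. }
exists (mkposreal _ Hm); intros r Hr Hr0.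
generalize (Rmin_l (1 / 2) (eps / (4 + 2 * c))) (Rmin_r (1 / 2) (eps / (4 + 2 * c))); intros Hm1 Hm2.
apply Rabs_def2 in Hr; unfold minus, plus, opp in Hr; simpl in Hr.
assert (Hr1 : 0 < r < 1) by lra.
rewrite g_gsq by trivial.
assert (Hx := pow2_unit r Hr1); assert (Hxr : r ^ 2 <= r / 2) by nra.
set (x := r ^ 2) in *.
assert (H1 := ln_arthq_upper x Hx); assert (H2 := ln_arthq_pos x Hx).
assert (H3 := ln_ellK_small x Hx).
assert (H4 : x / (1 - x) <= r).
{ apply Rmult_le_reg_r with (1 - x); [lra |]; replace (x / (1 - x) * (1 - x)) with x by (field; lra); nra. }
assert (H5 : r * (4 + 2 * c) < eps).
{ apply Rlt_le_trans with (eps / (4 + 2 * c) * (4 + 2 * c)); [apply Rmult_lt_compat_r; lra |].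
  right; field; lra. }
assert (0 <= (3 / 4 + c * x) * ln (arthq x) <= (1 + c) * r).
{ split; [apply Rmult_le_pos; nra | apply Rmult_le_compat; nra]. }
apply Rabs_def1; unfold minus, plus, opp; simpl; unfold gsq; nra.
Qed.

(** * Return to the variable r *)

Lemma is_derive_gsq_pow2 (c r : R) : 0 < r < 1 ->
  is_derive (fun r => gsq c (r ^ 2)) r (2 * r * gsq' c (r ^ 2)).
Proof.
intros Hr; assert (Hd := is_derive_gsq c (r ^ 2) (pow2_unit r Hr)).
assert (Hp : is_derive (fun r => r ^ 2) r (2 * r)) by (auto_derive; [trivial | simpl; ring]).
exact (is_derive_comp (V := R_NormedModule) (gsq c) (fun r => r ^ 2) r _ _ Hd Hp).
Qed.

(** The sign of G' enters: a product of nonnegative increasing factors is increasing. *)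
Lemma gsq'_pow2_increasing (c x y : R) :
  1 / 4 <= c -> 0 < x < 1 -> 0 < y < 1 -> x < y ->
  2 * x * gsq' c (x ^ 2) <= 2 * y * gsq' c (y ^ 2).
Proof.
intros Hc Hx Hy Hxy.
assert (H := gsq'_increasing c Hc (x ^ 2) (y ^ 2) (pow2_unit x Hx) (pow2_unit y Hy) ltac:(nra)).
assert (Hp := gsq'_pos c (x ^ 2) Hc (pow2_unit x Hx)).
apply Rmult_le_compat; lra.
Qed.

Lemma gsq'_pow2_decreasing (c x y : R) :
  0 < c <= 1 / 320 -> 0 < x < 1 -> 0 < y < 1 -> x < y ->
  2 * y * gsq' c (y ^ 2) <= 2 * x * gsq' c (x ^ 2).
Proof.
intros Hc Hx Hy Hxy.
assert (H := gsq'_decreasing c (proj2 Hc) (x ^ 2) (y ^ 2) (pow2_unit x Hx) (pow2_unit y Hy) ltac:(nra)).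
assert (Hp := gsq'_neg c (x ^ 2) Hc (pow2_unit x Hx)).
nra.
Qed.

Lemma convex_combination_unit (x y t : R) :
  0 < x < 1 -> 0 < y < 1 -> 0 <= t <= 1 -> 0 < t * x + (1 - t) * y < 1.
Proof.
intros Hx Hy Ht; assert (0 <= t * x <= t) by nra.
destruct (Req_dec t 0); [subst; lra |].
assert (0 < t * x < t) by nra; nra.
Qed.

Theorem theorem1p6 (c : R) (hc : 0 < c) :
  (strictly_increasing_on 0 1 (g c) <-> c >= 1 / 4) /\
  (strictly_decreasing_on 0 1 (g c) <-> c <= 1 / 320) /\
  is_lim_right (g c) 0 0 /\
  (c = 1 / 4 -> is_lim_left (g c) 1 (ln (PI / 2))) /\
  (c > 1 / 4 -> is_lim_left (g c) 1 p_infty) /\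
  (c < 1 / 4 -> is_lim_left (g c) 1 m_infty) /\
  (c >= 1 / 4 -> convex_on 0 1 (g c)) /\
  (c <= 1 / 320 -> concave_on 0 1 (g c)).
Proof.
repeat match goal with |- _ /\ _ => split end.
- split.
  + intros Hinc; apply Rnot_lt_ge; intros Hlt.
    (* For c < 1 / 4 the limit at 1 forces a value below g (1 / 2) at some r > 1 / 2. *)
    assert (HP : Rbar_locally m_infty (fun z => z < g c (1 / 2))) by (exists (g c (1 / 2)); auto).
    assert (H1 := is_lim_left_g_below c (conj hc Hlt) _ HP).
    unfold filtermap in H1.
    assert (H2 := at_left_1_intro (fun r => 1 / 2 < r < 1) (1 / 2) ltac:(lra) ltac:(intros; lra)).
    destruct (filter_ex _ (filter_and _ _ H1 H2)) as [r [Hr1 Hr2]].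
    assert (H := Hinc (1 / 2) r ltac:(lra) ltac:(lra) ltac:(lra)); lra.
  + intros Hc x y Hx Hy Hxy; rewrite !g_gsq by trivial.
    apply (lt_of_derive_pos (gsq c) (gsq' c) 0 1 (is_derive_gsq c));
      [intros; apply gsq'_pos; lra | now apply pow2_unit | now apply pow2_unit | nra].
- split.
  + intros Hdec; apply Rnot_lt_le; intros Hlt.
    destruct (gsq'_pos_near_0 c Hlt) as [d [Hd Hp]].
    (* The points r and r / 2 with r^2 = d / 2 have their squares in (0, d), where G' > 0. *)
    assert (Hs := sqrt_unit (d / 2) ltac:(lra)); assert (Hs2 := pow2_sqrt (d / 2) ltac:(lra)).
    set (r := sqrt (d / 2)) in *.
    assert (H := Hdec (r / 2) r ltac:(lra) ltac:(lra) ltac:(lra)).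
    rewrite !g_gsq in H by lra.
    assert (gsq c ((r / 2) ^ 2) < gsq c (r ^ 2)); [| lra].
    apply (lt_of_derive_pos (gsq c) (gsq' c) 0 d); [| exact Hp | nra | nra | nra].
    intros; apply is_derive_gsq; lra.
  + intros Hc x y Hx Hy Hxy; rewrite !g_gsq by trivial.
    apply (gt_of_derive_neg (gsq c) (gsq' c) 0 1 (is_derive_gsq c));
      [intros; apply gsq'_neg; lra | now apply pow2_unit | now apply pow2_unit | nra].
- now apply is_lim_right_g.
- intros ->; exact is_lim_left_g_quarter.
- intros Hc; now apply is_lim_left_g_above.
- intros Hc; now apply is_lim_left_g_below.
- intros Hc x y t Hx Hy Ht; rewrite !g_gsq by (trivial; now apply convex_combination_unit).
  apply (convex_of_derive (fun r => gsq c (r ^ 2)) (fun r => 2 * r * gsq' c (r ^ 2)) 0 1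
    (is_derive_gsq_pow2 c)); trivial.
  intros; apply gsq'_pow2_increasing; trivial; lra.
- intros Hc x y t Hx Hy Ht; rewrite !g_gsq by (trivial; now apply convex_combination_unit).
  apply (concave_of_derive (fun r => gsq c (r ^ 2)) (fun r => 2 * r * gsq' c (r ^ 2)) 0 1
    (is_derive_gsq_pow2 c)); trivial.
  intros; now apply gsq'_pow2_decreasing.
Qed.
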